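(* Let $\Omega=\mathbb Z_+^N$, $\mathbb Z_+=\{0,1,2,\dots\}$. Let $\nu$ be a probability measure on $\mathbb Z_+$ such that $$\nu(n)^2\ge\frac{n+1}{n}\,\nu(n+1)\,\nu(n-1),\qquad n\ge1.$$ Let $F_i:\mathbb Z_+\to\mathbb R$, $i\in[N]$, be arbitrary functions with $F_\infty:=\max_i\|F_i\|_\infty<\infty$, let $\mu_{0,i}$ be the probability measure on $\mathbb Z_+$ proportional to $\nu(x_i)e^{F_i(x_i)}$, and let $\mu_0(x)=\prod_{i=1}^N\mu_{0,i}(x_i)$. Let $\beta>0$, let $J_{i,j}\in\mathbb R$ satisfy $J_{i,i}=0$, $J_{i,j}=J_{j,i}$, and let $w_{i,j}:\mathbb Z_+\times\mathbb Z_+\to\mathbb R$ satisfy $\|w_{i,j}\|_\infty=\sup_{x_i,x_j}|w_{i,j}(x_i,x_j)|<\infty$. Let $$\mu(x)=\frac{\mu_0(x)\,e^{\beta W(x)}}{Z},\qquad W(x)=\frac12\sum_{i,j\in[N]}J_{i,j}\,w_{i,j}(x_i,x_j),$$ with $Z$ the normalizing factor. Set $\varepsilon_{i,k}=4\beta|J_{k,i}|\,\|w_{i,k}\|_\infty$ and suppose $$q:=\max_i\sum_{k:\,k\ne i}e^{\varepsilon_{i,k}}\big(e^{2\varepsilon_{i,k}}-1\big)<\frac23.$$ Then, with $C=(1-\frac32q)^{-1}$, for all bounded measurable $f:\Omega\to[0,\infty)$, $$\mathrm{Ent}_\mu(f)\le C\sum_{k=1}^N\mu\big[\mathrm{Ent}_{\mu_k}(f)\big].$$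 Moreover, one has the modified log-Sobolev inequality $$\mathrm{Ent}_\mu(f)\le K\sum_{i=1}^N\mu\big[\partial_if\,\partial_i\log f\big]$$ for all $f:\Omega\to[0,\infty)$, with constant $K=C\,C_0\,e^{1/3}$, where $C_0=e^{4F_\infty}\,\nu(1)/\nu(0)$.
   Context: Notation: $[N]=\{1,\dots,N\}$; $\mu[f]$ is the expectation of $f$ under $\mu$; $\mathrm{Ent}_\mu(f)=\mu[f\log f]-\mu[f]\log\mu[f]$. For each $k$, $\mu_k[f](x)=\mu[f\mid x_j,\ j\ne k]$ is the conditional expectation given all coordinates except the $k$-th, and $\mathrm{Ent}_{\mu_k}(f)$ is the function $\mu_k[f\log f]-\mu_k[f]\log\mu_k[f]$. For a function $f$ on $\Omega$, $\partial_if(x)=f(x+e_i)-f(x)$, where $e_i$ is the unit vector in the $i$-th direction.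
   Formalization: Adds the assumption that the sup norms of w_{i,j} and w_{j,i} agree (otherwise a star graph is a counterexample); for the modified log-Sobolev inequality also assumes ν(0)>0 and that the support of ν has no gaps (otherwise C_0 is undefined or a step function violates it). *)

(* Defs.v *)
From HB Require Import structures.
From mathcomp Require Import all_boot all_order all_algebra.
From mathcomp Require Import all_classical all_reals all_analysis.
Set Implicit Arguments.
Unset Strict Implicit.
Unset Printing Implicit Defensive.
Import Order.TTheory GRing.Theory Num.Theory.
Import numFieldNormedType.Exports.

Local Open Scope classical_set_scope.
Local Open Scope ring_scope.

(* The configuration space Z_+^N, with the product sigma-algebra, which here
   contains every subset. *)
Notation config N := (N.-tuple nat).

Section Norms.
Context {R : realType}.

(* Plain (not essential) supremum norm; it is +oo for an unbounded function. *)
Definition supnorm {T : Type} (f : T -> R) : \bar R :=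
  ereal_sup [set `|f x|%:E | x in [set: T]].

Definition supnorm2 (g : nat -> nat -> R) : \bar R :=
  supnorm (fun p : nat * nat => g p.1 p.2).

Definition normalize {T : choiceType} (g : T -> R) (x : T) : R :=
  g x / fine (\esum_(y in [set: T]) (g y)%:E)%E.

Definition mass (nu : probability nat R) (n : nat) : R := fine (nu [set n]).

End Norms.

Section Model.
Context {R : realType} {N : nat}.

(* A maximum over 'I_N of nonnegative quantities is taken with base value 0,
   which only matters for the empty index set. *)
Definition Fsup (F : 'I_N -> nat -> R) : \bar R :=
  (\big[maxe/0]_(i < N) supnorm (F i))%E.

Definition mu0_site (nu : probability nat R) (Fi : nat -> R) : nat -> R :=
  normalize (fun n => mass nu n * expR (Fi n)).

Definition mu0 (nu : probability nat R) (F : 'I_N -> nat -> R)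
    (x : config N) : R :=
  \prod_(i < N) mu0_site nu (F i) (tnth x i).

Definition W (J : 'I_N -> 'I_N -> R) (w : 'I_N -> 'I_N -> nat -> nat -> R)
    (x : config N) : R :=
  2^-1 * \sum_(i < N) \sum_(j < N) J i j * w i j (tnth x i) (tnth x j).

Definition gibbs_mass (nu : probability nat R) (F : 'I_N -> nat -> R) (beta : R)
    (J : 'I_N -> 'I_N -> R) (w : 'I_N -> 'I_N -> nat -> nat -> R) :
    config N -> R :=
  normalize (fun x => mu0 nu F x * expR (beta * W J w x)).

Definition eps (beta : R) (J : 'I_N -> 'I_N -> R)
    (w : 'I_N -> 'I_N -> nat -> nat -> R) (i k : 'I_N) : R :=
  4 * beta * `|J k i| * fine (supnorm2 (w i k)).

Definition qmax (beta : R) (J : 'I_N -> 'I_N -> R)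
    (w : 'I_N -> 'I_N -> nat -> nat -> R) : R :=
  \big[Num.max/0]_(i < N) \sum_(k < N | k != i)
    expR (eps beta J w i k) * (expR (2 * eps beta J w i k) - 1).

End Model.

Section Entropy.
Context {R : realType}.

(* [E] is an expectation operator and [0 <= f]; the negative part of f log f is
   bounded. The subtraction is the one for which +oo - +oo = +oo: the entropy
   of a function of infinite expectation is +oo. *)
Definition entropy {T : Type} (E : (T -> R) -> \bar R) (f : T -> R) : \bar R :=
  (E (fun x => (f x * ln (f x))%R) - (E f * lne (E f))%E)%dE.

Definition Ent {N : nat} (mu : probability (config N) R) (f : config N -> R) :
    \bar R :=
  entropy (fun g => 'E_mu[g])%E f.

(* The event that the configuration agrees with [x] at all sites but [k]. *)
Definition fiber {N : nat} (k : 'I_N) (x : config N) : set (config N) :=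
  [set y | forall j, j != k -> tnth y j = tnth x j].

(* Elementary conditional expectation given the values x_j, j != k; the
   configurations whose fiber is null form a null set. *)
Definition condE {N : nat} (mu : probability (config N) R) (k : 'I_N)
    (f : config N -> R) (x : config N) : \bar R :=
  ((\int[mu]_(y in fiber k x) (f y)%:E) / mu (fiber k x))%E.

Definition Ent_cond {N : nat} (mu : probability (config N) R) (k : 'I_N)
    (f : config N -> R) (x : config N) : \bar R :=
  entropy (fun g => condE mu k g x) f.

(* The configuration x + e_i. *)
Definition incr {N : nat} (i : 'I_N) (x : config N) : config N :=
  [tuple (tnth x j + (j == i))%N | j < N].

(* The product (d_i f)(d_i log f) at [x], for [0 <= f]. As [lne 0 = -oo], it is
   +oo when exactly one of f (x), f (x + e_i) vanishes, and 0 when both do. *)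
Definition dirichlet_density {N : nat} (i : 'I_N) (f : config N -> R)
    (x : config N) : \bar R :=
  ((f (incr i x) - f x)%:E * (lne (f (incr i x))%:E - lne (f x)%:E))%E.

End Entropy.

(* Main.v *)
(* Fix a finite box of configurations and write D_k f for the mean of the
   entropies of f under the conditional measures mu_k. The chain rule gives
   Ent f = D_k f + Ent (mu_k f), so averaging over k, the theorem follows from a
   contraction of sum_k D_k under f |-> mu_i f. This is a statement on two sites:
   if rho = f pi / pi[f] has marginal densities m and m' with respect to those of
   pi, then log z <= z - 1 bounds the loss in tensorizing the entropy of rho by
   the covariance of m and m' under pi. As pi is close to the product of its
   marginals, Pinsker's inequality bounds this covariance by a small multiple of
   the two marginal entropies, that is, of D_i f + D_k f plus the loss itself.
   The contraction improves any a priori constant geometrically to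
   (1 - 3q/2)^-1; an a priori constant comes from the product measure by bounded
   perturbation.

   For one ultra-log-concave site, binomial weights C(M, n) a(n) with a
   log-concave satisfy Ent f <= sum_n (n+1) C(M, n+1) a(n+1) A(f n, f (n+1)),
   where A is the Bregman divergence of x log x, by induction on M using Pascal's
   rule and a monotone coupling. With a(n) = nu(n) n! / M^n and M large this is the
   modified log-Sobolev inequality of nu, up to the replacement of the birth rate
   (n+1) nu(n+1) / nu(n) by its largest value nu(1) / nu(0).

   Both right-hand sides dominate their restrictions to boxes, so only the left-hand
   side requires a limit; f is shifted by d > 0 to stay away from zero. *)
Require Import Defs.
From HB Require Import structures.
From mathcomp Require Import all_boot all_order all_algebra.
From mathcomp Require Import all_classical all_reals all_analysis.
From mathcomp Require Import ring lra.
Set Implicit Arguments.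
Unset Strict Implicit.
Unset Printing Implicit Defensive.
Import Order.TTheory GRing.Theory Num.Theory.
Import numFieldNormedType.Exports.

Local Open Scope classical_set_scope.
Local Open Scope ring_scope.

(** * Bregman divergence of x log x *)

Section Bregman.
Context {R : realType}.
Implicit Types a t u v z : R.

(** The gap between [x log x] at [a] and its tangent at [t]. The factor [a] removes the logarithm at
    [a = 0], where the value is [t]. *)
Definition bregman a t := a * ln (a / t) - a + t.

Lemma ln_le_subr1 z : 0 < z -> ln z <= z - 1.
Proof.
move=> z0; rewrite -[in ln z](subrKC 1 z) le_ln1Dx//; lra.
Qed.

(** From [ln z <= z - 1] at [z = u r / v]. The minorant is linear in [(u, v)] and is attained at
    [r = v / u]: this is the dual form of the joint convexity of [bregman], suited to averaging over
    couplings. *)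
Lemma bregman_ge_linear u v r : 0 < u -> 0 <= v -> 0 < r ->
  v * ln r - u * r + u <= bregman v u.
Proof.
move=> u0 v0 r0; rewrite /bregman; case: (ltrgt0P v) v0 => // [v_gt0|->] _; last first.
  by rewrite !mul0r subr0 add0r; nra.
have -> : ln r = ln (u * r / v) + ln (v / u).
  rewrite -lnM ?posrE ?divr_gt0 ?mulr_gt0//; congr ln.
  by field; rewrite !gt_eqF.
have := @ln_le_subr1 (u * r / v) (divr_gt0 (mulr_gt0 u0 r0) v_gt0).
rewrite -(ler_pM2l v_gt0) mulrBr mulr1 mulrC (mulrC v (_ / _)) divfK ?gt_eqF//.
nra.
Qed.

Lemma bregman_ge0 a t : 0 <= a -> 0 < t -> 0 <= bregman a t.
Proof.
move=> a0 t0; have := bregman_ge_linear t0 a0 (@ltr01 R).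
by rewrite ln1 mulr0 mulr1 sub0r addNr.
Qed.

Lemma bregman_eq_linear u v : 0 < u -> 0 < v ->
  v * ln (v / u) - u * (v / u) + u = bregman v u.
Proof. by move=> u0 v0; rewrite /bregman [u * _]mulrC divfK ?gt_eqF. Qed.

(** For [r = (a + d) / (t + d)] the linear minorant of [bregman a t] exceeds the left-hand side by
    [d (r - 1 - ln r) >= 0]. *)
Lemma bregman_add a t d : 0 <= a -> 0 < t -> 0 < d ->
  bregman (a + d) (t + d) <= bregman a t.
Proof.
move=> a0 t0 d0; have ad : 0 < a + d by apply: ltr_wpDl.
have td : 0 < t + d by apply: addr_gt0.
have := bregman_ge_linear t0 a0 (divr_gt0 ad td).
have := ln_le_subr1 (divr_gt0 ad td).
rewrite -(ler_pM2l d0).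
set r := _ / _; have rE : r * (t + d) = a + d by rewrite /r divfK ?gt_eqF.
rewrite {2}/bregman -/r; nra.
Qed.

Lemma mulrB_ln_div_ge0 u v : 0 < u -> 0 < v -> 0 <= (v - u) * ln (v / u).
Proof.
move=> u0 v0; have := bregman_ge0 (ltW u0) v0; have := bregman_ge0 (ltW v0) u0.
rewrite /bregman !ln_div ?posrE//; nra.
Qed.

Lemma bregman_le_mulrB_ln u v : 0 < u -> 0 < v ->
  bregman v u <= (v - u) * ln (v / u).
Proof.
move=> u0 v0; have := bregman_ge0 (ltW u0) v0.
rewrite /bregman !ln_div ?posrE//; nra.
Qed.

(** This is the pointwise Pinsker inequality solved for [ln z]. The difference of the two sides,
    written as [k] in partial fractions, has derivative [(z - 1)^3 / (z^2 (z + 2)^2)], hence its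
    minimum, zero, at [z = 1]. *)
Lemma ln_ge_rational z : 0 < z ->
  (z - 1) * (5 * z + 1) / (2 * z * (z + 2)) <= ln z.
Proof.
move=> z0.
pose k y : R := ln y + (4^-1 * y^-1 + 27 / 4 * (y + 2)^-1) - 5 / 2.
pose dk y : R := (y - 1) ^+ 3 / (y ^+ 2 * (y + 2) ^+ 2).
have kd (y : R) : 0 < y -> is_derive y 1 k (dk y).
  move=> y0; have lny := is_derive1_ln y0.
  have yN0 : y != 0 by rewrite gt_eqF.
  have y2N0 : y + 2 != 0 by rewrite gt_eqF// addr_gt0.
  pose inv0 (y : R) : R := y^-1; pose inv2 (y : R) : R := (y + 2)^-1.
  have iy : is_derive y 1 inv0 (- y ^- 2 *: 1) by exact: is_deriveV.
  have iy2 : is_derive y 1 inv2 (- (y + 2) ^- 2 *: (1 + 0)).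
    exact: (@is_deriveV R (fun y => y + 2)).
  have -> : k = ((@ln R : R -> R) + (4^-1 \*: inv0 + (27 / 4) \*: inv2)
                : R -> R) - cst (5 / 2).
    exact/funext.
  have /is_derive_eq := is_deriveB (is_deriveD lny (is_deriveD (is_deriveZ 4^-1 iy)
    (is_deriveZ (27 / 4) iy2))) (is_derive_cst (5 / 2 : R) y (1 : R)).
  apply; rewrite /dk /GRing.scale/= !mulr1.
  by field; rewrite y2N0 yN0.
have kcont (a b : R) : 0 < a -> {within `[a, b], continuous k}.
  move=> a0; apply: derivable_within_continuous => x; rewrite in_itv/= => /andP[ax _].
  by have [] := kd x (lt_le_trans a0 ax).
have k1 : k 1 = 0 by rewrite /k ln1; field.
suff : 0 <= k z.
  suff -> : k z = ln z - (z - 1) * (5 * z + 1) / (2 * z * (z + 2)).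
    by rewrite subr_ge0.
  by rewrite /k; field; rewrite !gt_eqF// addr_gt0.
rewrite -k1; have [z1|z1] := leP 1 z.
- apply: (@ger0_derive1_le_cc _ k 1 z) => //; rewrite ?in_itv/= ?lexx ?z1//.
  + by move=> x /[!in_itv]/= /andP[x1 _]; have [] := kd x (lt_trans ltr01 x1).
  + move=> x /[!in_itv]/= /andP[x1 _]; have := kd x (lt_trans ltr01 x1).
    move=> kdx; rewrite derive1E derive_val /dk divr_ge0 ?exprn_ge0 ?mulr_ge0 ?exprn_ge0; lra.
  + exact: kcont.
- apply: (@ler0_derive1_le_cc _ k z 1) => //; rewrite ?in_itv/= ?lexx ?(ltW z1)//.
  + by move=> x /[!in_itv]/= /andP[x1 _]; have [] := kd x (lt_trans z0 x1).
  + move=> x /[!in_itv]/= /andP[zx x1]; have kdx := kd x (lt_trans z0 zx).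
    rewrite derive1E derive_val /dk mulr_le0_ge0//; last first.
      by rewrite invr_ge0 mulr_ge0// sqr_ge0.
    by rewrite exprS mulr_le0_ge0 ?sqr_ge0//; lra.
  + exact: kcont.
Qed.

Lemma pinsker_pointwise z : 0 < z ->
  3 * (z - 1) ^+ 2 <= (2 * z + 4) * (z * ln z - z + 1).
Proof.
move=> z0; have := ln_ge_rational z0.
have d0 : 0 < 2 * z * (z + 2) by rewrite !mulr_gt0// addr_gt0.
rewrite ler_pdivrMr//; nra.
Qed.
End Bregman.

(** * Averages, entropy and Pinsker's inequality for finite weights *)

Section WeightedAverages.
Context {R : realType}.

Definition avg {T : finType} (m f : T -> R) : R :=
  (\sum_t m t * f t) / \sum_t m t.

(** The weights are not normalised: this is their total mass times the entropy under the normalised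
    measure, and it scales linearly in [m]. *)
Definition went {T : finType} (m f : T -> R) : R :=
  \sum_t m t * (f t * ln (f t / avg m f)).

Section OneMeasure.
Variables (T : finType) (m f : T -> R).
Hypothesis m_ge0 : forall t, 0 <= m t.
Hypothesis m_gt0 : 0 < \sum_t m t.
Hypothesis f_gt0 : forall t, 0 < f t.

Lemma wsum_gt0 : 0 < \sum_t m t * f t.
Proof.
rewrite lt0r sumr_ge0 ?andbT; last by move=> t _; rewrite mulr_ge0// ltW.
apply: contraL m_gt0 => /eqP /psumr_eq0P h.
rewrite big1 ?ltxx// => t _; apply/eqP; rewrite -(mulrI_eq0 _ (mulfI (lt0r_neq0 (f_gt0 t)))).
by rewrite mulrC h// => i _; rewrite mulr_ge0// ltW.
Qed.

Lemma avg_gt0 : 0 < avg m f.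
Proof. by rewrite divr_gt0// wsum_gt0. Qed.

Lemma wsum_avg : \sum_t m t * f t = avg m f * \sum_t m t.
Proof. by rewrite /avg divfK// gt_eqF. Qed.

Lemma went_bregman : went m f = \sum_t m t * bregman (f t) (avg m f).
Proof.
rewrite /bregman; under [RHS]eq_bigr do rewrite -addrA mulrDr mulrDr mulrN.
rewrite 2!big_split/= sumrN -mulr_suml -[X in X * _]mulr1 wsum_avg /went.
by rewrite mulr1 mulrC addNr addr0.
Qed.

(** The mean is the best base point: moving from it to [a] costs exactly the total mass times
    [bregman (avg m f) a]. *)
Lemma went_le_bregman (a : R) :
  0 < a -> went m f <= \sum_t m t * bregman (f t) a.
Proof.
move=> a0; rewrite went_bregman -subr_ge0.
have := wsum_avg; have := avg_gt0; move: (avg m f) => b b0 wE.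
suff -> : \sum_t m t * bregman (f t) a - \sum_t m t * bregman (f t) b =
    bregman b a * \sum_t m t.
  by rewrite mulr_ge0 ?bregman_ge0 ?ltW.
rewrite -sumrB.
transitivity (\sum_t (ln (b / a) * (m t * f t) + (a - b) * m t)).
  by apply: eq_bigr => t _; rewrite /bregman !ln_div ?posrE ?f_gt0//; ring.
by rewrite big_split/= -!mulr_sumr wE /bregman; ring.
Qed.

Lemma went_ge0 : 0 <= went m f.
Proof.
rewrite went_bregman sumr_ge0// => t _.
by rewrite mulr_ge0// bregman_ge0 ?avg_gt0// ltW.
Qed.

(** Cauchy-Schwarz applied to the pointwise inequality at [z = f t / avg m f], as a family of
    quadratic bounds with parameter [c]; the best choice is [c = S / (2 F)]. *)
Lemma pinsker :
  (\sum_t m t * `|f t - avg m f|) ^+ 2 <= 2 * (\sum_t m t * f t) * went m f.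
Proof.
have := avg_gt0; set a := avg m f => a0.
set S := \sum_t _; set F := \sum_t _.
have F0 : 0 < F by exact: wsum_gt0.
have S0 : 0 <= S by apply: sumr_ge0 => t _; rewrite mulr_ge0.
have step (c : R) : 0 < c -> 2 * S <= c * (2 * F) + went m f / c.
  move=> c0; rewrite went_bregman -/a.
  have -> : c * (2 * F) = \sum_t m t * (c * (2 * f t + 4 * a) / 3).
    transitivity (\sum_t (c * 2 / 3 * (m t * f t) + c * 4 / 3 * a * m t)).
      rewrite big_split/= -!mulr_sumr -/F.
      have -> : F = a * \sum_t m t by exact: wsum_avg.
      by field.
    by apply: eq_bigr => t _; field.
  rewrite /S mulr_sumr mulr_suml -big_split/=; apply: ler_sum => t _.
  rewrite -[_ * _ / c]mulrA -mulrDr mulrCA ler_wpM2l//.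
  have z0 : 0 < f t / a by rewrite divr_gt0.
  set b := bregman _ _; set d := `|_|.
  have h : 3 * d ^+ 2 <= (2 * f t + 4 * a) * b.
    have := pinsker_pointwise z0.
    rewrite -(ler_pM2l (exprn_gt0 2 a0)); congr (_ <= _).
      by rewrite /d real_normK ?num_real//; field; rewrite gt_eqF.
    by rewrite /b /bregman; field; rewrite gt_eqF.
  have d0 : 0 <= d by exact: normr_ge0.
  have -> : c * (2 * f t + 4 * a) / 3 + b / c =
    (c ^+ 2 * (2 * f t + 4 * a) / 3 + b) / c by field; rewrite gt_eqF.
  rewrite ler_pdivlMr//; move: h; set q := 2 * f t + 4 * a => h.
  have q0 : 0 < q by rewrite addr_gt0// mulr_gt0.
  rewrite -(ler_pM2l q0).
  have := sqr_ge0 (c * q - 3 * d); nra.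
move: S0; rewrite le_eqVlt => /predU1P[<-|S0].
  by rewrite expr0n/= mulr_ge0 ?went_ge0// mulr_ge0// ltW.
have := step (S / (2 * F)) (divr_gt0 S0 (mulr_gt0 (ltr0Sn R 1) F0)).
rewrite divfK ?gt_eqF ?mulr_gt0// invf_div.
have -> : 2 * S = S + S by ring.
by rewrite lerD2l mulrA ler_pdivlMr// expr2 [_ * (2 * F)]mulrC.
Qed.

End OneMeasure.

End WeightedAverages.

(** * Two interacting sites *)

Section LnDiv.
Context {R : realType}.
Implicit Types a b c d : R.

Lemma ln_div2 a b c d : 0 < a -> 0 < b -> 0 < c -> 0 < d ->
  ln (a / b) - ln (c / d) = ln (d / b) - ln (c / a).
Proof. by move=> *; rewrite !ln_div ?posrE//; ring. Qed.

Lemma ln_mulf_div2 a b c d : 0 < a -> 0 < b -> 0 < c -> 0 < d ->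
  ln (a * b / c / d) = ln (a / c) - ln (d / b).
Proof.
by move=> *; rewrite !ln_div ?lnM ?posrE ?divr_gt0 ?mulr_gt0//; ring.
Qed.

Lemma ln_div_split b a c : 0 < a -> 0 < b -> 0 < c ->
  ln (a / c) = ln (a / b) + ln (b / c).
Proof. by move=> *; rewrite !ln_div ?posrE//; ring. Qed.

End LnDiv.

Section TwoSites.
Context {R : realType}.
Variables (X Y : finType) (p : X -> R) (r : Y -> R) (g f : X -> Y -> R) (s : R).
Hypothesis p_ge0 : forall x, 0 <= p x.
Hypothesis r_ge0 : forall y, 0 <= r y.
Hypothesis p_gt0 : 0 < \sum_x p x.
Hypothesis r_gt0 : 0 < \sum_y r y.
Hypothesis g_gt0 : forall x y, 0 < g x y.
Hypothesis f_gt0 : forall x y, 0 < f x y.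
Hypothesis s_ge0 : 0 <= s.
Hypothesis s_lt : 2 * s < 1.
Hypothesis g_mixed : forall x x' y y',
  g x y * g x' y' <= (1 + s) * (g x' y * g x y').

(** For the joint weights [p x * r y * g x y], [rw x] and [pw y] are the unnormalised conditional
    laws, [G1] and [G2] the marginal densities with respect to [p] and [r], [m] and [fb] the
    conditional means of [f], and [g0] its overall mean. *)
Let rw x y := r y * g x y.
Let pw y x := p x * g x y.
Let G1 x := \sum_y rw x y.
Let G2 y := \sum_x pw y x.
Let m x := avg (rw x) (f x).
Let fb y := avg (pw y) (f^~ y).
Let Z := \sum_x p x * G1 x.
Let F := \sum_x \sum_y p x * (rw x y * f x y).
Let g0 := F / Z.

Let rw_ge0 x y : 0 <= rw x y. Proof. by rewrite mulr_ge0// ltW. Qed.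
Let pw_ge0 y x : 0 <= pw y x. Proof. by rewrite mulr_ge0// ltW. Qed.
Let G1_gt0 x : 0 < G1 x. Proof. exact: wsum_gt0. Qed.
Let G2_gt0 y : 0 < G2 y. Proof. by apply: (@wsum_gt0 _ _ p (g^~ y)). Qed.
Let m_gt0 x : 0 < m x. Proof. exact: (avg_gt0 (rw_ge0 x) (G1_gt0 x) (f_gt0 x)). Qed.
Let fb_gt0 y : 0 < fb y.
Proof. exact: (avg_gt0 (pw_ge0 y) (G2_gt0 y) (f_gt0^~ y)). Qed.
Let Z_gt0 : 0 < Z. Proof. exact: wsum_gt0. Qed.

Let FE1 : F = \sum_x p x * G1 x * m x.
Proof.
apply: eq_bigr => x _; rewrite -mulr_sumr (@wsum_avg _ _ (rw x) (f x) (G1_gt0 x)).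
by rewrite -/(m x) -mulrA [m x * _]mulrC.
Qed.

Let sumC (H : X -> Y -> R) : \sum_x \sum_y p x * (rw x y * H x y) =
  \sum_y \sum_x r y * (pw y x * H x y).
Proof.
rewrite exchange_big/=; apply: eq_bigr => y _; apply: eq_bigr => x _.
by rewrite /rw /pw; ring.
Qed.

Let FE2 : F = \sum_y r y * G2 y * fb y.
Proof.
rewrite /F sumC; apply: eq_bigr => y _.
rewrite -mulr_sumr (@wsum_avg _ _ (pw y) (f^~ y) (G2_gt0 y)).
by rewrite -/(fb y) -mulrA [fb y * _]mulrC.
Qed.

Let ZE2 : Z = \sum_y r y * G2 y.
Proof.
rewrite /Z; under eq_bigr do rewrite mulr_sumr; rewrite exchange_big/=.
apply: eq_bigr => y _; rewrite mulr_sumr; apply: eq_bigr => x _.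
by rewrite /rw /pw; ring.
Qed.

Let P1_ge0 x : 0 <= p x * G1 x. Proof. by rewrite mulr_ge0// ltW. Qed.
Let P2_ge0 y : 0 <= r y * G2 y. Proof. by rewrite mulr_ge0// ltW. Qed.
Let P2_gt0 : 0 < \sum_y r y * G2 y. Proof. by rewrite -ZE2. Qed.
Let F_gt0 : 0 < F. Proof. by rewrite FE1; apply: wsum_gt0. Qed.
Let g0_gt0 : 0 < g0. Proof. by rewrite divr_gt0. Qed.
Let ZgF : Z * g0 = F. Proof. by rewrite mulrC divfK// gt_eqF. Qed.

(** [A] and [B] are the entropies of the conditional means, [D1] and [D2] the mean conditional
    entropies, and [L] is the loss in tensorization. *)
Let A := went (fun x => p x * G1 x) m.
Let B := went (fun y => r y * G2 y) fb.
Let D1 := \sum_x p x * went (rw x) (f x).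
Let D2 := \sum_y r y * went (pw y) (f^~ y).
Let L := \sum_x \sum_y p x * (rw x y * (fb y * m x / g0 - f x y)).

Let AE : A = \sum_x \sum_y p x * (rw x y * (f x y * ln (m x / g0))).
Proof.
rewrite /A /went /avg -FE1 -/Z -/g0; apply: eq_bigr => x _.
rewrite -mulr_sumr -mulrA; congr (_ * _); under eq_bigr do rewrite mulrA.
by rewrite -mulr_suml (@wsum_avg _ _ (rw x) (f x) (G1_gt0 x)) -/(m x) /G1; ring.
Qed.

Let BE : B = \sum_x \sum_y p x * (rw x y * (f x y * ln (fb y / g0))).
Proof.
rewrite /B /went /avg -FE2 -ZE2 -/g0 sumC; apply: eq_bigr => y _.
rewrite -mulr_sumr -mulrA; congr (_ * _); under eq_bigr do rewrite mulrA.
by rewrite -mulr_suml (@wsum_avg _ _ (pw y) (f^~ y) (G2_gt0 y)) -/(fb y) /G2; ring.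
Qed.

Let D1E : D1 = \sum_x \sum_y p x * (rw x y * (f x y * ln (f x y / m x))).
Proof. by apply: eq_bigr => x _; rewrite mulr_sumr. Qed.

Let D2E : D2 = \sum_x \sum_y p x * (rw x y * (f x y * ln (f x y / fb y))).
Proof. by rewrite sumC; apply: eq_bigr => y _; rewrite mulr_sumr. Qed.

(** The bound [ln z <= z - 1] at [z = fb y * m x / (g0 * f x y)]. It serves both [B - D1 <= L] and
    [A - D2 <= L], whose logarithmic terms coincide. *)
Let lnprod_le x y : f x y * (ln (fb y / g0) - ln (f x y / m x)) <=
  fb y * m x / g0 - f x y.
Proof.
have fm := divr_gt0 (mulr_gt0 (fb_gt0 y) (m_gt0 x)) g0_gt0.
have := ln_le_subr1 (divr_gt0 fm (f_gt0 x y)).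
rewrite -(ler_pM2l (f_gt0 x y)) mulrBr mulr1 [f x y * (_ / _)]mulrC divfK ?gt_eqF//.
suff -> : ln (fb y * m x / g0 / f x y) = ln (fb y / g0) - ln (f x y / m x) by [].
exact: ln_mulf_div2.
Qed.

Let B_le : B <= D1 + L.
Proof.
rewrite -lerBlDl BE D1E /L -sumrB; apply: ler_sum => x _.
rewrite -sumrB; apply: ler_sum => y _.
by rewrite -!mulrBr ler_wpM2l// ler_wpM2l.
Qed.

Let A_le : A <= D2 + L.
Proof.
rewrite -lerBlDl AE D2E /L -sumrB; apply: ler_sum => x _.
rewrite -sumrB; apply: ler_sum => y _.
rewrite -!mulrBr ler_wpM2l// ler_wpM2l// (le_trans _ (lnprod_le x y))//.
suff -> : ln (m x / g0) - ln (f x y / fb y) = ln (fb y / g0) - ln (f x y / m x) by [].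
exact: ln_div2.
Qed.

(** Both [m] and [fb] have mean [g0], so [g0 * L] is their unnormalised covariance. *)
Let LE : g0 * L = \sum_x \sum_y p x * (rw x y * ((fb y - g0) * (m x - g0))).
Proof.
have e (x : X) (y : Y) : p x * (rw x y * ((fb y - g0) * (m x - g0))) =
  g0 * (p x * (rw x y * (fb y * m x / g0 - f x y)))
  + g0 * (p x * (rw x y * f x y)) - g0 * (p x * m x * rw x y)
  - g0 * (p x * (rw x y * fb y)) + g0 ^+ 2 * (p x * rw x y).
  by field; rewrite gt_eqF.
under [RHS]eq_bigr do under eq_bigr do rewrite e.
under [RHS]eq_bigr do rewrite !(big_split, sumrN)/= -!mulr_sumr.
rewrite !(big_split, sumrN)/= -!mulr_sumr -/F.
have -> : \sum_x p x * m x * \sum_y rw x y = F.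
  by rewrite FE1; apply: eq_bigr => x _; rewrite -/(G1 x); ring.
have -> : \sum_x p x * \sum_y rw x y * fb y = F.
  under eq_bigr do rewrite mulr_sumr; rewrite (sumC (fun _ => fb)) FE2.
  by apply: eq_bigr => y _; rewrite -mulr_sumr -mulr_suml mulrA.
rewrite -/Z /L; under [X in _ = g0 * X + _ - _ - _ + _]eq_bigr do rewrite mulr_sumr.
have -> : \sum_x p x * \sum_y rw x y * f x y = F.
  by apply: eq_bigr => x _; rewrite mulr_sumr.
by rewrite -ZgF; ring.
Qed.

(** Both products are sums over [(x', y')] with the same weights, of [g x y * g x' y'] and of
    [g x' y * g x y']; [g_mixed] compares the terms in both directions. The joint law is thus within
    relative error [s] of the product of its marginals. *)
Let h_close x y : `|Z * g x y - G1 x * G2 y| <= s * (G1 x * G2 y).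
Proof.
have ZE : Z = \sum_x' \sum_y' p x' * r y' * g x' y'.
  apply: eq_bigr => x' _; rewrite mulr_sumr; apply: eq_bigr => y' _.
  by rewrite /rw mulrA.
have GE : G1 x * G2 y = \sum_x' \sum_y' p x' * r y' * (g x' y * g x y').
  rewrite /G1 /G2 mulrC mulr_suml; apply: eq_bigr => x' _.
  by rewrite mulr_sumr; apply: eq_bigr => y' _; rewrite /rw /pw; ring.
have u1 : Z * g x y <= (1 + s) * (G1 x * G2 y).
  rewrite ZE GE mulr_suml mulr_sumr; apply: ler_sum => x' _.
  rewrite mulr_suml mulr_sumr; apply: ler_sum => y' _.
  rewrite -mulrA [leRHS]mulrCA ler_wpM2l ?mulr_ge0// mulrC; exact: g_mixed.
have u2 : G1 x * G2 y <= (1 + s) * (Z * g x y).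
  rewrite ZE GE mulr_suml mulr_sumr; apply: ler_sum => x' _.
  rewrite mulr_suml mulr_sumr; apply: ler_sum => y' _.
  rewrite -[in leRHS]mulrA [leRHS]mulrCA ler_wpM2l ?mulr_ge0//.
  by rewrite [g x' y' * _]mulrC; exact: g_mixed.
have GG : 0 < G1 x * G2 y by rewrite mulr_gt0.
have Zg : 0 < Z * g x y by rewrite mulr_gt0.
rewrite ler_norml; apply/andP; split; last lra.
move: u1 u2 GG Zg; set a := Z * _; set b := G1 x * _ => u1 u2 GG Zg.
have := s_lt; have := s_ge0; nra.
Qed.

(** The covariance vanishes under the product of the marginals, so only the difference bounded by
    [h_close] enters. It leaves [s] times a product of two L1 deviations, which Pinsker's inequality
    bounds by the entropies. *)
Let L_le : L <= s * (A + B).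
Proof.
pose S1 := \sum_x p x * G1 x * `|m x - g0|.
pose S2 := \sum_y r y * G2 y * `|fb y - g0|.
have avg1 : avg (fun x => p x * G1 x) m = g0 by rewrite /avg -FE1.
have avg2 : avg (fun y => r y * G2 y) fb = g0 by rewrite /avg -FE2 -ZE2.
have pin1 : S1 ^+ 2 <= 2 * F * A.
  by have := pinsker P1_ge0 Z_gt0 m_gt0; rewrite avg1 -FE1.
have pin2 : S2 ^+ 2 <= 2 * F * B.
  by have := pinsker P2_ge0 P2_gt0 fb_gt0; rewrite avg2 -FE2.
have z1 : \sum_x p x * G1 x * (m x - g0) = 0.
  under eq_bigr do rewrite mulrBr; rewrite sumrB -FE1 -mulr_suml -/Z ZgF; ring.
have cov : Z * (g0 * L) <= s * (S1 * S2).
  have -> : Z * (g0 * L) = \sum_x \sum_y p x * r y * (fb y - g0) * (m x - g0) *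
      (Z * g x y - G1 x * G2 y).
    rewrite LE; apply/esym/eqP; rewrite -subr_eq0; apply/eqP.
    rewrite mulr_sumr -sumrB.
    under eq_bigr do rewrite mulr_sumr -sumrB.
    transitivity (\sum_x \sum_y (p x * G1 x * (m x - g0)) *
       (- (r y * G2 y * (fb y - g0)))).
      by apply: eq_bigr => x _; apply: eq_bigr => y _; rewrite /rw; ring.
    by under eq_bigr do rewrite -mulr_sumr; rewrite -mulr_suml z1 mul0r.
  have -> : s * (S1 * S2) = \sum_x \sum_y p x * r y * `|fb y - g0| * `|m x - g0| *
      (s * (G1 x * G2 y)).
    rewrite /S1 mulr_suml mulr_sumr; apply: eq_bigr => x _.
    by rewrite /S2 mulrA mulr_sumr; apply: eq_bigr => y _; ring.
  apply: ler_sum => x _; apply: ler_sum => y _.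
  rewrite (le_trans (ler_norm _))// !normrM (ger0_norm (p_ge0 x)) (ger0_norm (r_ge0 y)).
  by rewrite ler_wpM2l// !mulr_ge0.
have am : S1 * S2 <= F * (A + B) by have := sqr_ge0 (S1 - S2); nra.
move: cov; rewrite mulrA ZgF => cov.
rewrite -(ler_pM2l F_gt0) (le_trans cov)// [leRHS]mulrCA ler_wpM2l//.
Qed.

(** The left-hand side is at most [B], because [g0] is a worse base point than the conditional
    averages of [fb]. Then [B <= D1 + L], and [L <= s (A + B) <= s (D1 + D2 + 2 L)] is solved for
    [L]. *)
Lemma went_avg_two_sites :
  \sum_x p x * went (rw x) fb <= D1 + s / (1 - 2 * s) * (D1 + D2).
Proof.
apply: (@le_trans _ _ B).
  have -> : B = \sum_x p x * \sum_y rw x y * bregman (fb y) g0.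
    rewrite /B went_bregman// /avg -FE2 -ZE2 -/g0.
    under [RHS]eq_bigr do rewrite mulr_sumr.
    rewrite (sumC (fun _ y => bregman (fb y) g0)); apply: eq_bigr => y _.
    by rewrite -mulr_sumr -mulr_suml mulrA.
  by apply: ler_sum => x _; rewrite ler_wpM2l//; exact: (went_le_bregman (rw_ge0 x) (G1_gt0 x) fb_gt0).
have s1 : 0 < 1 - 2 * s by rewrite subr_gt0.
have LAB : L * (1 - 2 * s) <= s * (D1 + D2).
  have := L_le; have := A_le; have := B_le; have := s_ge0; nra.
rewrite (le_trans B_le)// lerD2l mulrAC ler_pdivlMr//.
Qed.

End TwoSites.

(** * Gibbs weights on a finite box *)

Section Update.
Variables (I T : finType).
Implicit Types (x : {ffun I -> T}) (i k : I) (t s : T).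

Definition upd x k t : {ffun I -> T} := [ffun j => if j == k then t else x j].

Lemma updK x k t t' : upd (upd x k t) k t' = upd x k t'.
Proof. by apply/ffunP => j; rewrite !ffunE; case: eqP. Qed.

Lemma upd_id x k : upd x k (x k) = x.
Proof. by apply/ffunP => j; rewrite !ffunE; case: eqP => [->|]. Qed.

Lemma updC x i k s t : i != k -> upd (upd x i s) k t = upd (upd x k t) i s.
Proof.
move=> ik; apply/ffunP => j; rewrite !ffunE.
by have [->|//] := eqVneq j k; rewrite eq_sym (negbTE ik).
Qed.

(** The map [(x, t) |-> (upd x k t, x k)] is an involution. Fibrewise sums can thus be indexed by
    all configurations, each fibre counted [#|T|] times, without choosing representatives. *)
Lemma sum_upd {R : realType} k (G : {ffun I -> T} -> R) :
  \sum_x \sum_t G (upd x k t) = #|T|%:R * \sum_x G x.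
Proof.
rewrite pair_big/=.
pose h (u : {ffun I -> T} * T) := (upd u.1 k u.2, u.1 k).
rewrite (reindex h)/=; last first.
  by exists h => -[x t] _; rewrite /h/= updK upd_id ffunE eqxx.
under eq_bigr do rewrite updK upd_id.
rewrite -(pair_big predT predT (fun x (_ : T) => G x))/= mulr_sumr.
by apply: eq_bigr => x _; rewrite sumr_const mulr_natl.
Qed.

End Update.

Section FiniteGibbs.
Context {R : realType}.
Variables (I T : finType) (p : I -> T -> R) (V : {ffun I -> T} -> R).
Hypothesis p_ge0 : forall i t, 0 <= p i t.
Variable x0 : {ffun I -> T}.
Hypothesis p_x0 : forall i, 0 < p i (x0 i).
Implicit Types (f h : {ffun I -> T} -> R) (x : {ffun I -> T}) (i k : I).

Definition gibbsw x : R := (\prod_i p i (x i)) * expR (V x).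
(** [gibbsw] factors at site [k] into [restw], which does not see coordinate [k], and [kernw], the
    unnormalised conditional law of that coordinate. [siteent] is the unnormalised
    [mu[Ent_{mu_k}(f)]]. *)
Definition kernw k x t : R := p k t * expR (V (upd x k t)).
Definition restw k x : R := \prod_(i | i != k) p i (x i).
Definition condavg k f x : R := avg (kernw k x) (fun t => f (upd x k t)).
Definition siteent k f : R :=
  \sum_x gibbsw x * (f x * ln (f x / condavg k f x)).

Lemma gibbsw_ge0 x : 0 <= gibbsw x.
Proof. by rewrite mulr_ge0 ?expR_ge0 ?prodr_ge0. Qed.

Lemma gibbsw_gt0 : 0 < \sum_x gibbsw x.
Proof.
rewrite (bigD1 x0)//= ltr_pwDl ?sumr_ge0 ?mulr_gt0 ?expR_gt0 ?prodr_gt0//.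
by move=> x _; exact: gibbsw_ge0.
Qed.

Lemma kernw_ge0 k x t : 0 <= kernw k x t.
Proof. by rewrite mulr_ge0// expR_ge0. Qed.

Lemma sum_p_gt0 k : 0 < \sum_t p k t.
Proof. by rewrite (bigD1 (x0 k))//= ltr_pwDl ?sumr_ge0. Qed.

Lemma kernw_gt0 k x : 0 < \sum_t kernw k x t.
Proof.
by apply: (wsum_gt0 (p_ge0 k) (sum_p_gt0 k)) => t; exact: expR_gt0.
Qed.

Lemma restw_ge0 k x : 0 <= restw k x.
Proof. by rewrite prodr_ge0. Qed.

Lemma gibbsw_upd k x t : gibbsw (upd x k t) = restw k x * kernw k x t.
Proof.
rewrite /gibbsw /kernw (bigD1 k)//= ffunE eqxx mulrA; congr (_ * _).
rewrite mulrC; congr (_ * _); apply: eq_bigr => i ik.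
by rewrite ffunE (negbTE ik).
Qed.

Lemma kernw_upd k x t : kernw k (upd x k t) = kernw k x.
Proof. by apply/funext => s; rewrite /kernw updK. Qed.

Lemma condavg_upd k f x t : condavg k f (upd x k t) = condavg k f x.
Proof.
rewrite /condavg kernw_upd; congr avg.
by apply/funext => s; rewrite updK.
Qed.

Lemma condavg_gt0 k f : (forall x, 0 < f x) -> forall x, 0 < condavg k f x.
Proof. move=> f0 x; exact: (avg_gt0 (kernw_ge0 k x) (kernw_gt0 k x)). Qed.

Lemma card_site_gt0 k : 0 < #|T|%:R :> R.
Proof. by rewrite ltr0n; apply/card_gt0P; exists (x0 k). Qed.

Lemma sum_gibbsw k (G : {ffun I -> T} -> R) :
  #|T|%:R * (\sum_x gibbsw x * G x) =
  \sum_x restw k x * \sum_t kernw k x t * G (upd x k t).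
Proof.
rewrite -(sum_upd k (fun x => gibbsw x * G x)); apply: eq_bigr => x _.
by rewrite mulr_sumr; apply: eq_bigr => t _; rewrite gibbsw_upd mulrA.
Qed.

Lemma siteentE k f : #|T|%:R * siteent k f =
  \sum_x restw k x * went (kernw k x) (fun t => f (upd x k t)).
Proof.
rewrite (sum_gibbsw k (fun x => f x * ln (f x / condavg k f x))).
apply: eq_bigr => x _; congr (_ * _); apply: eq_bigr => t _.
by rewrite condavg_upd.
Qed.

Lemma siteent_ge0 k f : (forall x, 0 < f x) -> 0 <= siteent k f.
Proof.
move=> f0; rewrite -(pmulr_rge0 _ (card_site_gt0 k)) siteentE sumr_ge0// => x _.
by rewrite mulr_ge0 ?restw_ge0// went_ge0 ?kernw_gt0// => t; exact: kernw_ge0.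
Qed.

Lemma sum_condavg k f h : (forall x t, h (upd x k t) = h x) ->
  \sum_x gibbsw x * (condavg k f x * h x) = \sum_x gibbsw x * (f x * h x).
Proof.
move=> hk; apply: (mulfI (lt0r_neq0 (card_site_gt0 k))).
rewrite (sum_gibbsw k (fun x => condavg k f x * h x)).
rewrite (sum_gibbsw k (fun x => f x * h x)).
apply: eq_bigr => x _; congr (_ * _).
under eq_bigr do rewrite condavg_upd hk mulrA.
under [RHS]eq_bigr do rewrite hk mulrA.
rewrite -!mulr_suml; congr (_ * _).
by rewrite (wsum_avg (fun t => f (upd x k t)) (kernw_gt0 k x)) mulrC.
Qed.

(** The chain rule: the logarithm is split at [condavg k f], and the second part does not depend on
    coordinate [k], so [f] may be averaged there. *)
Lemma went_condavg k f : (forall x, 0 < f x) ->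
  went gibbsw f = siteent k f + went gibbsw (condavg k f).
Proof.
move=> f0.
have avgE : avg gibbsw (condavg k f) = avg gibbsw f.
  congr (_ / _).
  have := @sum_condavg k f (fun=> 1) (fun _ _ => erefl).
  by under eq_bigr do rewrite mulr1; under [in RHS]eq_bigr do rewrite mulr1.
rewrite /went avgE; have := avg_gt0 gibbsw_ge0 gibbsw_gt0 f0.
move: (avg gibbsw f) => a a0.
rewrite (@sum_condavg k f (fun x => ln (condavg k f x / a))); last first.
  by move=> x t; rewrite condavg_upd.
rewrite /siteent -big_split/=; apply: eq_bigr => x _.
rewrite -mulrDr -mulrDr; congr (_ * (_ * _)).
by apply: ln_div_split => //; exact: condavg_gt0.
Qed.

Section TwoSitesCond.
Variables (i k : I) (s : R).
Hypothesis ik : i != k.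
Hypothesis s_ge0 : 0 <= s.
Hypothesis s_lt : 2 * s < 1.
Hypothesis V_mixed : forall x t t' u u',
  expR (V (upd (upd x i t) k u) + V (upd (upd x i t') k u')) <=
  (1 + s) * expR (V (upd (upd x i t') k u) + V (upd (upd x i t) k u')).

Let rest2 x : R := \prod_(j | (j != i) && (j != k)) p j (x j).

Let restw_i x t : restw k (upd x i t) = rest2 x * p i t.
Proof.
rewrite /restw /rest2 (bigD1 i)//= ffunE eqxx mulrC; congr (_ * _).
apply: eq_big => [j|j /andP[jk ji]]; first by rewrite andbC.
by rewrite ffunE (negbTE ji).
Qed.

Let restw_k x t : restw i (upd x k t) = rest2 x * p k t.
Proof.
rewrite /restw (bigD1 k) 1?eq_sym//= ffunE eqxx mulrC; congr (_ * _).
by apply: eq_bigr => j /andP[ji jk]; rewrite ffunE (negbTE jk).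
Qed.

Let siteent_k f : #|T|%:R * (#|T|%:R * siteent k f) = \sum_x rest2 x *
  \sum_t p i t * went (fun u => p k u * expR (V (upd (upd x i t) k u)))
                      (fun u => f (upd (upd x i t) k u)).
Proof.
rewrite siteentE -(sum_upd i); apply: eq_bigr => x _; rewrite mulr_sumr.
by apply: eq_bigr => t _; rewrite restw_i mulrA.
Qed.

Let siteent_i f : #|T|%:R * (#|T|%:R * siteent i f) = \sum_x rest2 x *
  \sum_u p k u * went (fun t => p i t * expR (V (upd (upd x i t) k u)))
                      (fun t => f (upd (upd x i t) k u)).
Proof.
rewrite siteentE -(sum_upd k); apply: eq_bigr => x _; rewrite mulr_sumr.
apply: eq_bigr => u _; rewrite restw_k mulrA; congr (_ * went _ _).
  by apply/funext => t; rewrite /kernw -updC.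
by apply/funext => t; rewrite -updC.
Qed.

Lemma siteent_condavg f : (forall x, 0 < f x) ->
  siteent k (condavg i f) <=
  siteent k f + s / (1 - 2 * s) * (siteent k f + siteent i f).
Proof.
move=> f0; have T0 := card_site_gt0 k.
rewrite -(ler_pM2l T0) -(ler_pM2l T0).
set c := s / _.
have -> (u v : R) : #|T|%:R * (#|T|%:R * (u + c * (u + v))) =
    #|T|%:R * (#|T|%:R * u) + c * (#|T|%:R * (#|T|%:R * u) + #|T|%:R * (#|T|%:R * v)).
  by ring.
rewrite !siteent_k siteent_i -big_split/= mulr_sumr -big_split/=.
apply: ler_sum => x _; rewrite -mulrDr [X in _ + X]mulrCA -mulrDr.
rewrite ler_wpM2l ?prodr_ge0//.
have e t : (fun u => condavg i f (upd (upd x i t) k u)) =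
    (fun u => avg (fun t => p i t * expR (V (upd (upd x i t) k u)))
                  (fun t => f (upd (upd x i t) k u))).
  apply/funext => u; rewrite /condavg; congr avg; apply/funext => t'.
    by rewrite /kernw 2!(updC _ _ _ ik) updK.
  by rewrite 2!(updC _ _ _ ik) updK.
under eq_bigr do rewrite e.
apply: (@went_avg_two_sites R T T (p i) (p k)
  (fun t u => expR (V (upd (upd x i t) k u)))
  (fun t u => f (upd (upd x i t) k u)) s) => //; try exact: sum_p_gt0.
- by move=> *; exact: expR_gt0.
- by move=> t t' u u'; rewrite -!expRD.
Qed.

End TwoSitesCond.

End FiniteGibbs.

(** The Holley-Stroock comparison: with the average under [m'] as common base point, the entropies
    are bounded by sums of nonnegative terms, monotone in the weights. *)
Lemma went_le_scale {R : realType} (T : finType) (m m' f : T -> R) (c : R) :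
  (forall t, 0 <= m t) -> 0 < \sum_t m t ->
  (forall t, 0 <= m' t) -> 0 < \sum_t m' t ->
  (forall t, m t <= c * m' t) -> (forall t, 0 < f t) ->
  went m f <= c * went m' f.
Proof.
move=> m0 mp m'0 m'p mm' f0; rewrite (went_bregman _ m'p) mulr_sumr.
rewrite (le_trans (went_le_bregman m0 mp f0 (avg_gt0 m'0 m'p f0)))//.
by apply: ler_sum => t _; rewrite mulrA ler_wpM2r// bregman_ge0 ?avg_gt0// ltW.
Qed.

(** * Tensorization for product weights *)

Section ProductMeasure.
Context {R : realType}.
Variables (I T : finType) (p : I -> T -> R).
Hypothesis p_ge0 : forall i t, 0 <= p i t.
Variable x0 : {ffun I -> T}.
Hypothesis p_x0 : forall i, 0 < p i (x0 i).
Let V0 : {ffun I -> T} -> R := fun=> 0.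
Implicit Types (f : {ffun I -> T} -> R) (x : {ffun I -> T}) (i k : I).

(** Without interaction the mixed ratio is one, so the two-site inequality holds with [s = 0]. *)
Let siteent_condavg0 i k f : i != k -> (forall x, 0 < f x) ->
  siteent p V0 k (condavg p V0 i f) <= siteent p V0 k f.
Proof.
move=> ik f0.
have s0 : 2 * 0 < 1 :> R by rewrite mulr0.
have := @siteent_condavg R I T p V0 p_ge0 x0 p_x0 i k 0 ik (lexx 0) s0.
rewrite mul0r => /(_ _ f f0); rewrite mul0r [leRHS]addr0; apply.
by move=> *; rewrite !addr0 mul1r lexx.
Qed.

Let condavgs f (s : seq I) := foldl (fun g k => condavg p V0 k g) f s.

Let condavgs_gt0 f s : (forall x, 0 < f x) -> forall x, 0 < condavgs f s x.
Proof.
by elim: s f => //= k s IHs f f0; apply: IHs => x; exact: condavg_gt0.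
Qed.

Let went_condavgs f s : uniq s -> (forall x, 0 < f x) ->
  went (gibbsw p V0) f <=
  \sum_(k <- s) siteent p V0 k f + went (gibbsw p V0) (condavgs f s).
Proof.
elim: s f => [|k s IHs] f /=; first by rewrite big_nil add0r.
move=> /andP[ks us] f0; rewrite big_cons -addrA (went_condavg V0 p_ge0 p_x0 k)//.
have c0 : forall x, 0 < condavg p V0 k f x by exact: condavg_gt0.
rewrite lerD2l (le_trans (IHs _ us c0))// lerD2r.
rewrite big_seq [leRHS]big_seq; apply: ler_sum => j js.
by apply: siteent_condavg0 => //; apply: contraNneq ks => ->.
Qed.

Let condavg_indep f i k : (forall x t, f (upd x i t) = f x) ->
  forall x t, condavg p V0 k f (upd x i t) = condavg p V0 k f x.
Proof.
move=> fi x t; have [->|ik] := eqVneq i k; first by rewrite condavg_upd.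
by rewrite /condavg; congr avg; apply/funext => u; rewrite updC// fi.
Qed.

Let condavgs_indep f s i : i \in s ->
  forall x t, condavgs f s (upd x i t) = condavgs f s x.
Proof.
have keep g r : (forall x t, g (upd x i t) = g x) ->
    forall x t, condavgs g r (upd x i t) = condavgs g r x.
  by elim: r g => //= k r IHr g gi; apply: IHr; exact: condavg_indep.
elim: s f => //= k s IHs f; rewrite inE => /predU1P[ik|/IHs//].
by apply: keep => x t; rewrite ik condavg_upd.
Qed.

(** The chain rule is applied at each site in turn. Averaging over one site does not increase the
    terms of the others, and once all sites are averaged the function is constant. *)
Lemma tensorization_product f : (forall x, 0 < f x) ->
  went (gibbsw p V0) f <= \sum_k siteent p V0 k f.
Proof.
move=> f0; rewrite (le_trans (went_condavgs (enum_uniq I) f0))//.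
rewrite big_enum/=; set g := condavgs f _.
have g0 : forall x, 0 < g x by exact: condavgs_gt0.
have gE x : g x = g x0.
  have agree (s : seq I) (y z : {ffun I -> T}) : (forall j, j \notin s -> y j = z j) -> g y = g z.
    elim: s y => [|k s IHs] y yz.
      by congr g; apply/ffunP => j; exact: yz.
    have <- : g (upd y k (z k)) = g y by apply: condavgs_indep; rewrite mem_enum.
    apply: IHs => j js; rewrite ffunE; case: eqP => [->//|/eqP jk].
    by apply: yz; rewrite inE negb_or jk.
  by apply: (agree (enum I)) => j; rewrite mem_enum.
suff -> : went (gibbsw p V0) g = 0 by rewrite addr0.
have avgE : avg (gibbsw p V0) g = g x0.
  rewrite /avg; under eq_bigr do rewrite gE.
  by rewrite -mulr_suml mulrAC divff ?mul1r // gt_eqF// (gibbsw_gt0 _ p_ge0 p_x0).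
by rewrite /went big1// => x _; rewrite avgE gE divff ?gt_eqF// ln1 !mulr0.
Qed.

End ProductMeasure.

(** * Tensorization with interaction, by contraction *)

Section FiniteTensorization.
Context {R : realType}.
Variables (I T : finType) (p : I -> T -> R) (V : {ffun I -> T} -> R).
Hypothesis p_ge0 : forall i t, 0 <= p i t.
Variable x0 : {ffun I -> T}.
Hypothesis p_x0 : forall i, 0 < p i (x0 i).
Implicit Types (f : {ffun I -> T} -> R) (x : {ffun I -> T}) (i k : I).

(* Only the finiteness of [C] matters: the contraction improves it. *)
Lemma tensorization_crude : exists2 C : R, 0 <= C &
  forall f, (forall x, 0 < f x) ->
    went (gibbsw p V) f <= C * \sum_k siteent p V k f.
Proof.
pose B := \sum_x `|V x|; pose V0 : {ffun I -> T} -> R := fun=> 0.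
have VB x : `|V x| <= B by rewrite /B (bigD1 x)//= lerDl sumr_ge0.
exists (expR B * expR B) => [|f f0]; first by rewrite mulr_ge0 ?expR_ge0.
have le1 : went (gibbsw p V) f <= expR B * went (gibbsw p V0) f.
  apply: went_le_scale => //; try exact: gibbsw_ge0; try exact: gibbsw_gt0.
  move=> x; rewrite /gibbsw expR0 mulr1 mulrC ler_wpM2r ?prodr_ge0//.
  by rewrite ler_expR (le_trans (ler_norm _)).
rewrite (le_trans le1)// -mulrA ler_wpM2l ?expR_ge0//.
rewrite (le_trans (tensorization_product p_ge0 p_x0 f0))// mulr_sumr.
apply: ler_sum => k _; have T0 := @card_site_gt0 R I T x0 k.
rewrite -(ler_pM2l T0) mulrCA !siteentE// mulr_sumr; apply: ler_sum => x _.
rewrite mulrCA ler_wpM2l ?restw_ge0//.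
apply: went_le_scale => //; try (by move=> t; exact: kernw_ge0);
  try exact: (kernw_gt0 _ p_ge0 p_x0).
move=> t; rewrite /kernw expR0 mulr1 mulrCA ler_peMr//.
rewrite -expRD -expR0 ler_expR; have := VB (upd x k t).
by rewrite ler_norml => /andP[+ _]; lra.
Qed.

Let siteent_condavgE k f : (forall x, 0 < f x) ->
  siteent p V k (condavg p V k f) = 0.
Proof.
move=> f0; have c0 := condavg_gt0 V p_ge0 p_x0 k f0.
rewrite /siteent big1// => x _.
suff -> : condavg p V k (condavg p V k f) x = condavg p V k f x.
  by rewrite divff ?gt_eqF// ln1 !mulr0.
rewrite [LHS]/condavg /avg; under eq_bigr do rewrite condavg_upd.
by rewrite -mulr_suml mulrAC divff ?mul1r // gt_eqF// (kernw_gt0 V p_ge0 p_x0).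
Qed.

Section Contraction.
Variable (s : I -> I -> R) (kappa : R).
Hypothesis s_sym : forall i k, s i k = s k i.
Hypothesis s_ge0 : forall i k, 0 <= s i k.
Hypothesis s_lt : forall i k, i != k -> 2 * s i k < 1.
Hypothesis V_mixed : forall i k x t t' u u', i != k ->
  expR (V (upd (upd x i t) k u) + V (upd (upd x i t') k u')) <=
  (1 + s i k) * expR (V (upd (upd x i t') k u) + V (upd (upd x i t) k u')).
Hypothesis kappa_lt1 : kappa < 1.
Hypothesis s_kappa : forall i,
  \sum_(k | k != i) 2 * (s i k / (1 - 2 * s i k)) <= kappa.

Let a i k := s i k / (1 - 2 * s i k).

(** Averaging at [i] annihilates the term of site [i] and adds at most [a i k * (d k + d i)] to that
    of [k]. Summed over [i], the first effect gives [#|I| - 1], and the symmetry of [s] collects the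
    second into [\sum_k 2 * a i k <= kappa] for each site. *)
Let sum_siteent_condavg f : (forall x, 0 < f x) ->
  \sum_i \sum_k siteent p V k (condavg p V i f) <=
  (#|I|%:R - 1 + kappa) * \sum_k siteent p V k f.
Proof.
move=> f0; pose d k := siteent p V k f.
have d0 k : 0 <= d k by exact: siteent_ge0.
have -> : (#|I|%:R - 1 + kappa) * \sum_k siteent p V k f =
    \sum_i (\sum_k d k - d i) + kappa * \sum_k d k.
  rewrite sumrB sumr_const -mulr_natl -/d; ring.
have step i : \sum_k siteent p V k (condavg p V i f) <=
    (\sum_k d k - d i) + \sum_(k | k != i) a i k * (d k + d i).
  rewrite [\sum_k d k](bigD1 i)//= [d i + _]addrC addrK.
  rewrite (bigD1 i)//= siteent_condavgE// add0r -big_split/=.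
  apply: ler_sum => k ki; rewrite eq_sym in ki.
  exact: (siteent_condavg p_ge0 p_x0 ki (s_ge0 i k) (s_lt ki) (fun x t t' u u' => V_mixed x t t' u u' ki)).
rewrite (le_trans (ler_sum _ (fun i _ => step i)))// big_split/= lerD2l.
have -> : \sum_i \sum_(k | k != i) a i k * (d k + d i) =
    \sum_i (\sum_(k | k != i) 2 * a i k) * d i.
  transitivity (\sum_i \sum_(k | k != i) a i k * d k +
                \sum_i \sum_(k | k != i) a i k * d i).
    rewrite -big_split/=; apply: eq_bigr => i _.
    by rewrite -big_split/=; apply: eq_bigr => k _; rewrite mulrDr.
  rewrite (exchange_big_dep predT)//= -big_split/=; apply: eq_bigr => i _.
  rewrite -!mulr_suml -mulrDl; congr (_ * _).
  under [X in X + _]eq_bigl do rewrite eq_sym.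
  rewrite -big_split/=; apply: eq_bigr => k _.
  by rewrite {1}/a s_sym -/(a i k); ring.
rewrite mulr_sumr; apply: ler_sum => i _.
by rewrite ler_wpM2r ?s_kappa.
Qed.

(** The chain rule summed over the [n] sites improves a constant [C'] to
    [(1 + C' (n - 1 + kappa)) / n]. This affine map has fixed point [1 / (1 - kappa)] and slope
    [q < 1], so its iterates converge to that point. *)
Lemma tensorization_contraction f : (forall x, 0 < f x) ->
  went (gibbsw p V) f <= (1 - kappa)^-1 * \sum_k siteent p V k f.
Proof.
move=> f0.
have Phi_ge0 (g : {ffun I -> T} -> R) : (forall x, 0 < g x) -> 0 <= \sum_k siteent p V k g.
  by move=> g0; rewrite sumr_ge0// => k _; exact: siteent_ge0.
have [C C0 Cf] := tensorization_crude.
have c0 : 0 < 1 - kappa by rewrite subr_gt0.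
have [n0|n0] := posnP #|I|.
  rewrite (le_trans (Cf f f0))// !big1 ?mulr0// => k.
  by have := card0_eq n0 k; rewrite inE.
have nR : 0 < #|I|%:R :> R by rewrite ltr0n.
have nR1 : 1 <= #|I|%:R :> R by rewrite ler1n.
have kappa0 : 0 <= kappa.
  have [i _] := card_gt0P n0; rewrite (le_trans _ (s_kappa i))// sumr_ge0// => k ki.
  by rewrite mulr_ge0// divr_ge0// subr_ge0 ltW// s_lt// eq_sym.
pose q := (#|I|%:R - 1 + kappa) / #|I|%:R : R.
have q0 : 0 <= q by rewrite divr_ge0// addr_ge0// subr_ge0.
have q1 : q < 1 by rewrite ltr_pdivrMr// mul1r; lra.
have improve (m : nat) (g : {ffun I -> T} -> R) : (forall x, 0 < g x) -> went (gibbsw p V) g <=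
    ((1 - kappa)^-1 + q ^+ m * C) * \sum_k siteent p V k g.
  elim: m g => [|m IHm] g g0.
    rewrite expr0 mul1r (le_trans (Cf g g0))// ler_wpM2r ?Phi_ge0//.
    by rewrite lerDr invr_ge0 ltW.
  set C' := _^-1 + _ * C in IHm.
  have C'0 : 0 <= C' by rewrite addr_ge0 ?mulr_ge0 ?exprn_ge0// invr_ge0 ltW.
  have cg0 i := condavg_gt0 V p_ge0 p_x0 i g0.
  have : #|I|%:R * went (gibbsw p V) g <=
      \sum_k siteent p V k g + C' * ((#|I|%:R - 1 + kappa) * \sum_k siteent p V k g).
    have -> : #|I|%:R * went (gibbsw p V) g =
        \sum_i siteent p V i g + \sum_i went (gibbsw p V) (condavg p V i g).
      rewrite -big_split/= mulr_natl -sumr_const; apply: eq_bigr => i _.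
      exact: went_condavg.
    rewrite lerD2l (le_trans _ (ler_wpM2l C'0 (sum_siteent_condavg g0)))//.
    by rewrite mulr_sumr; apply: ler_sum => i _; exact: IHm.
  rewrite mulrC -ler_pdivlMr// => /le_trans; apply; rewrite le_eqVlt; apply/orP; left.
  apply/eqP; rewrite /C' exprS /q; field.
  by rewrite !gt_eqF.
have cv : (((1 - kappa)^-1 + q ^+ m * C) * \sum_k siteent p V k f) @[m --> \oo] -->
    ((1 - kappa)^-1 + 0 * C) * \sum_k siteent p V k f.
  apply: cvgMr_tmp; apply: cvgD; first exact: cvg_cst.
  by apply: cvgMr_tmp; apply: cvg_expr; rewrite ger0_norm.
move: cv; rewrite mul0r addr0 => cv.
rewrite -(cvg_lim _ cv)//; apply: limr_ge; first by apply/cvg_ex; eexists; exact: cv.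
by apply: nearW => m; exact: improve.
Qed.

End Contraction.

(** With [s = e^eps - 1] the summand is [s (1 + s) (2 + s)]. Being below [2/3] it forces [s <= 1/4],
    where [2 s / (1 - 2 s)] is at most [3/2] times it; the contraction thus applies with
    [kappa = 3 q / 2]. *)
Lemma tensorization (eps : I -> I -> R) (q : R) :
  (forall i k, eps i k = eps k i) -> (forall i k, 0 <= eps i k) ->
  (forall i k x t t' u u', i != k ->
     V (upd (upd x i t) k u) + V (upd (upd x i t') k u') <=
     eps i k + (V (upd (upd x i t') k u) + V (upd (upd x i t) k u'))) ->
  (forall i, \sum_(k | k != i) expR (eps i k) * (expR (2 * eps i k) - 1) <= q) ->
  q < 2 / 3 ->
  forall f, (forall x, 0 < f x) ->
  went (gibbsw p V) f <= (1 - 3 / 2 * q)^-1 * \sum_k siteent p V k f.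
Proof.
move=> eC e0 Vm eq ql.
pose s i k := expR (eps i k) - 1.
have s0 i k : 0 <= s i k by rewrite subr_ge0 -expR0 ler_expR.
have sE i k : expR (eps i k) * (expR (2 * eps i k) - 1) =
    (1 + s i k) * (s i k * (2 + s i k)).
  by rewrite mulr_natl mulr2n expRD /s; ring.
(* The increasing cubic takes the value [45/64 > 2/3] at [s = 1/4]. *)
have s4 i k : i != k -> s i k <= 4^-1.
  move=> ik; have : (1 + s i k) * (s i k * (2 + s i k)) < 2 / 3.
    rewrite -sE (le_lt_trans _ ql)// (le_trans _ (eq i))//.
    rewrite (bigD1 k) 1?eq_sym//= lerDl sumr_ge0// => j _.
    by rewrite sE; have := s0 i j; nra.
  have := s0 i k; nra.
apply: (@tensorization_contraction s).
- by move=> i k; rewrite /s eC.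
- exact: s0.
- by move=> i k ik; have := s4 i k ik; lra.
- move=> i k x t t' u u' ik; rewrite /s subrKC -expRD ler_expR; exact: Vm.
- lra.
- move=> i; rewrite (le_trans _ (ler_wpM2l _ (eq i)))//.
  rewrite mulr_sumr; apply: ler_sum => k ki; rewrite sE.
  have := s0 i k; have := s4 i k; rewrite eq_sym => /(_ ki) h1 h0.
  rewrite mulrA ler_pdivrMr; last lra.
  move: (s i k) h0 h1 => r h0 h1; nra.
Qed.

End FiniteTensorization.

(** * Ultra-log-concave weights *)

Section Binomial.
Context {R : realType}.
Implicit Types (a f b : nat -> R).

(** Taking [u] instead of the mean [F] as base point removes the term of mass [al] and costs
    [(al + be) * bregman F u >= 0]. *)
Let bernoulli_went (u v F al be : R) : 0 < u -> 0 < v -> 0 < F ->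
  0 <= al -> 0 <= be -> (al + be) * F = al * u + be * v ->
  al * (u * ln (u / F)) + be * (v * ln (v / F)) <= be * bregman v u.
Proof.
move=> u0 v0 F0 al0 be0 FE; rewrite -subr_ge0.
have -> : be * bregman v u - (al * (u * ln (u / F)) + be * (v * ln (v / F))) =
    (al + be) * bregman F u.
  rewrite /bregman; transitivity ((al + be) * F * (ln (F / u) - 1) + (al + be) * u).
    by rewrite FE !ln_div ?posrE//; ring.
  by ring.
by rewrite mulr_ge0 ?bregman_ge0 ?(ltW F0)// addr_ge0.
Qed.

(* The pairs (u, v), (v, w), (v, v) couple the two averages F and G monotonically;
   log-concavity makes the weight of (u, v) at most [be]. *)
Let bregman_coupling (u v w F G al be ga : R) :
  0 < u -> 0 < v -> 0 < w -> 0 < F -> 0 < G ->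
  0 <= al -> 0 <= be -> 0 <= ga -> 0 < al + be -> al * ga <= be * be ->
  (al + be) * F = al * u + be * v -> (be + ga) * G = be * v + ga * w ->
  (be + ga) * bregman G F <= be * bregman v u + ga * bregman w v.
Proof.
move=> u0 v0 w0 F0 G0 al0 be0 ga0 ab lc FE GE.
pose l := (be + ga) * al / (al + be).
have l0 : 0 <= l by rewrite divr_ge0 ?mulr_ge0 ?addr_ge0.
have lb : l <= be by rewrite ler_pdivrMr//; lra.
have r0 : 0 < G / F by rewrite divr_gt0.
have h1 := bregman_ge_linear u0 (ltW v0) r0.
have h2 := bregman_ge_linear v0 (ltW w0) r0.
have h3 := bregman_ge_linear v0 (ltW v0) r0.
have vv : bregman v v = 0 by rewrite /bregman divff ?gt_eqF// ln1 mulr0 sub0r addNr.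
rewrite vv in h3.
rewrite -(bregman_eq_linear F0 G0); set r := G / F in h1 h2 h3 *.
have lF : (be + ga) * F = l * u + (be + ga - l) * v.
  have -> : F = (al * u + be * v) / (al + be) by rewrite -FE [_ * F]mulrC mulfK// gt_eqF.
  by rewrite /l; field; rewrite gt_eqF.
have -> : (be + ga) * (G * ln r - F * r + F) =
    (be + ga) * G * ln r - (be + ga) * F * (r - 1) by ring.
rewrite lF GE; have b0 := bregman_ge0 (ltW v0) u0.
have k1 := ler_wpM2l l0 h1; have k2 := ler_wpM2l ga0 h2.
have bl : 0 <= be - l by rewrite subr_ge0.
have k3 := ler_wpM2l bl h3; have k4 := ler_wpM2r b0 lb.
rewrite mulr0 in k3.
apply: (@le_trans _ _ (l * bregman v u + ga * bregman w v)); last by rewrite lerD2r.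
apply: (@le_trans _ _ (l * (v * ln r - u * r + u) + ga * (w * ln r - v * r + v)
  + (be - l) * (v * ln r - v * r + v))).
  by rewrite le_eqVlt; apply/orP; left; apply/eqP; ring.
by lra.
Qed.

Let sum_pascal M b :
  \sum_(n < M.+2) 'C(M.+1, n)%:R * b n =
  \sum_(n < M.+1) 'C(M, n)%:R * (b n + b n.+1).
Proof.
under [RHS]eq_bigr do rewrite mulrDr; rewrite big_split/=.
rewrite big_ord_recl/= [in RHS]big_ord_recl/= !bin0.
rewrite -addrA; congr (_ + _).
under eq_bigr do rewrite /bump/= add1n binS natrD mulrDl.
rewrite big_split/=; congr (_ + _).
by rewrite big_ord_recr/= bin_small// mul0r addr0.
Qed.

(** One trial is split off: the other [M] trials have weights built on [a' n = a n + a n.+1], again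
    log-concave, and [F n] is the conditional mean of [f]. The chain rule leaves two-point entropies
    ([step1]) and the entropy of [F], treated by induction and the coupling ([step2]). This form of
    log-concavity, with [0 < a 0], also rules out internal zeros. *)
Lemma went_binomial M a f : (forall n, 0 <= a n) -> 0 < a 0 ->
  (forall n m, (n <= m)%N -> a n * a m.+1 <= a n.+1 * a m) ->
  (forall n, 0 < f n) ->
  went (fun n : 'I_M.+1 => 'C(M, n)%:R * a n) (fun n => f n) <=
  \sum_(n < M) n.+1%:R * 'C(M, n.+1)%:R * (a n.+1 * bregman (f n.+1) (f n)).
Proof.
elim: M a f => [|M IHM] a f a0 a00 lc f0.
  rewrite big_ord0 /went /avg !big_ord1/= bin0 !mul1r.
  by rewrite [a 0 * f 0]mulrC mulfK ?gt_eqF// divff ?gt_eqF// ln1 !mulr0.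
pose a' n := a n + a n.+1.
(* The default [1] keeps [F] positive; [FE] persists where [a' n = 0], both weights being zero
   there. *)
pose F n := if a' n == 0 then 1 else (a n * f n + a n.+1 * f n.+1) / a' n.
have a'0 n : 0 <= a' n by rewrite addr_ge0.
have FE n : a' n * F n = a n * f n + a n.+1 * f n.+1.
  rewrite /F; case: eqP => [/eqP|/eqP a'N0]; last by rewrite mulrC divfK.
  by rewrite paddr_eq0// => /andP[/eqP e1 /eqP e2]; rewrite /a' e1 e2; ring.
have F0 n : 0 < F n.
  rewrite /F; case: eqP => // /eqP a'N0; rewrite divr_gt0//; last first.
    by rewrite lt0r a'N0/=.
  have af k j : 0 <= a k * f j by rewrite mulr_ge0// ltW.
  rewrite lt0r addr_ge0// andbT; apply: contraNneq a'N0 => /eqP.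
  rewrite paddr_eq0// !mulf_eq0 !(gt_eqF (f0 _)) !orbF.
  by move=> /andP[/eqP e1 /eqP e2]; rewrite /a' e1 e2 addr0.
have lc' n m : (n <= m)%N -> a' n * a' m.+1 <= a' n.+1 * a' m.
  rewrite leq_eqVlt => /predU1P[->|nm]; first by rewrite mulrC.
  have h1 := lc n m (ltnW nm); have h2 := lc n m.+1 (leqW (ltnW nm)).
  have h3 := lc n.+1 m nm; have h4 := lc n.+1 m.+1 (leqW nm).
  by rewrite /a'; lra.
have a'00 : 0 < a' 0 by rewrite ltr_pwDl.
have SE : \sum_(n < M.+2) 'C(M.+1, n)%:R * a n = \sum_(n < M.+1) 'C(M, n)%:R * a' n.
  exact: sum_pascal.
have avgE : avg (fun n : 'I_M.+2 => 'C(M.+1, n)%:R * a n) (fun n => f n) =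
    avg (fun n : 'I_M.+1 => 'C(M, n)%:R * a' n) (fun n => F n).
  rewrite /avg SE; congr (_ / _).
  under eq_bigr do rewrite -mulrA; rewrite (sum_pascal M (fun n => a n * f n)).
  by apply: eq_bigr => n _; rewrite -FE mulrA.
have A0 : 0 < avg (fun n : 'I_M.+1 => 'C(M, n)%:R * a' n) (fun n => F n).
  apply: avg_gt0 => // [n|]; first by rewrite mulr_ge0.
  rewrite big_ord_recl/= bin0 mul1r ltr_pwDl// sumr_ge0// => n _.
  by rewrite mulr_ge0.
have -> : went (fun n : 'I_M.+2 => 'C(M.+1, n)%:R * a n) (fun n => f n) =
    went (fun n : 'I_M.+1 => 'C(M, n)%:R * a' n) (fun n => F n) +
    \sum_(n < M.+1) 'C(M, n)%:R * (a n * (f n * ln (f n / F n)) +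
                                   a n.+1 * (f n.+1 * ln (f n.+1 / F n))).
  rewrite /went avgE; move: (avg _ _) A0 => A A0.
  under eq_bigr do rewrite -mulrA.
  rewrite (sum_pascal M (fun n => a n * (f n * ln (f n / A)))) -big_split/=.
  apply: eq_bigr => n _; rewrite -mulrA -mulrDr; congr (_ * _).
  rewrite (@ln_div_split _ (F n) (f n) A)// (@ln_div_split _ (F n) (f n.+1) A)//.
  by rewrite [a' n * _]mulrA FE; ring.
have step1 n : a n * (f n * ln (f n / F n)) + a n.+1 * (f n.+1 * ln (f n.+1 / F n))
    <= a n.+1 * bregman (f n.+1) (f n).
  by apply: bernoulli_went => //; exact: FE.
have step2 n : a' n.+1 * bregman (F n.+1) (F n) <=
    a n.+1 * bregman (f n.+1) (f n) + a n.+2 * bregman (f n.+2) (f n.+1).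
  have [/eqP|a'N0] := eqVneq (a' n) 0.
    rewrite paddr_eq0// => /andP[_ /eqP an1].
    have an2 : a n.+2 = 0.
      apply/eqP; rewrite eq_le a0 andbT -(pmulr_rle0 _ a00).
      by rewrite (le_trans (lc 0 n.+1 _))// an1 mulr0.
    by rewrite /a' an1 an2 addr0 !mul0r addr0.
  apply: bregman_coupling (FE n) (FE n.+1) => //.
  - by rewrite lt0r addr_ge0// andbT.
  - exact: lc.
pose c n := a n.+1 * bregman (f n.+1) (f n).
rewrite (le_trans (lerD (IHM a' F a'0 a'00 lc' F0) (ler_sum _
  (fun (n : 'I_M.+1) _ => ler_wpM2l (ler0n R 'C(M, n)) (step1 n)))))//.
apply: (@le_trans _ _ (\sum_(n < M) n.+1%:R * 'C(M, n.+1)%:R * (c n + c n.+1) +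
  \sum_(n < M.+1) 'C(M, n)%:R * c n)).
  rewrite lerD2r; apply: ler_sum => n _.
  by rewrite ler_wpM2l ?mulr_ge0//; exact: step2.
under [X in X + _]eq_bigr do rewrite mulrDr; rewrite big_split/=.
have -> : \sum_(n < M) n.+1%:R * 'C(M, n.+1)%:R * c n =
    \sum_(n < M.+1) n.+1%:R * 'C(M, n.+1)%:R * c n.
  by rewrite [RHS]big_ord_recr/= bin_small// mulr0 mul0r addr0.
have -> : \sum_(n < M) n.+1%:R * 'C(M, n.+1)%:R * c n.+1 =
    \sum_(n < M.+1) n%:R * 'C(M, n)%:R * c n.
  by rewrite [RHS]big_ord_recl/= !mul0r add0r.
(* Termwise, [(n+1) C(M, n+1) + n C(M, n) + C(M, n) = (n+1) C(M+1, n+1)]. *)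
rewrite -!big_split/=; apply: ler_sum => n _.
rewrite binS natrD -/(c n) -natr1 le_eqVlt; apply/orP; left; apply/eqP; ring.
Qed.

End Binomial.

(** * Modified log-Sobolev inequality for one ultra-log-concave law *)

Section UltraLogConcave.
Context {R : realType}.
Variable nu : nat -> R.
Hypothesis nu_ge0 : forall n, 0 <= nu n.
Hypothesis nu_gt0 : 0 < nu 0.
Hypothesis nu_supp : forall n, nu n = 0 -> nu n.+1 = 0.
Hypothesis nu_ulc : forall n, (1 <= n)%N ->
  n.+1%:R / n%:R * nu n.+1 * nu n.-1 <= nu n ^+ 2.

(** Up to a constant, the density of [nu] with respect to a Poisson law; [nu_ulc] says that it is
    log-concave. *)
Let al n : R := nu n * n`!%:R.

Let al_ge0 n : 0 <= al n. Proof. by rewrite mulr_ge0. Qed.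

(** The local inequalities [al k * al k.+2 <= al k.+1 ^+ 2] are chained upwards from [m = n];
    [nu_supp] makes the cancelled factor [al k] positive whenever [al k.+1] is. *)
Let al_lc n m : (n <= m)%N -> al n * al m.+1 <= al n.+1 * al m.
Proof.
move=> nm; rewrite -(subnKC nm); elim: (m - n)%N => [|d IHd].
  by rewrite addn0 mulrC.
rewrite addnS; set k := (n + d)%N in IHd *.
have lc1 : al k * al k.+2 <= al k.+1 ^+ 2.
  have h : (k.+2%:R / k.+1%:R * nu k.+2 * nu k) * (k.+1)`!%:R ^+ 2 <=
      nu k.+1 ^+ 2 * (k.+1)`!%:R ^+ 2.
    by rewrite ler_wpM2r ?sqr_ge0//; exact: (nu_ulc (ltn0Sn k)).
  rewrite /al exprMn (le_trans _ h)// le_eqVlt; apply/orP; left; apply/eqP.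
  rewrite (factS k.+1) (factS k) !natrM; field.
  by rewrite ?nat1r ?natr1 pnatr_eq0.
have [alk1|alk1] := eqVneq (al k.+1) 0.
  suff -> : al k.+2 = 0 by rewrite alk1 !mulr0.
  move/eqP: alk1; rewrite mulf_eq0 [_%:R == 0]pnatr_eq0 -[_ == 0%N]negbK -lt0n.
  by rewrite fact_gt0 orbF => /eqP /nu_supp nu0; rewrite /al nu0 mul0r.
have alk : 0 < al k.
  rewrite lt0r al_ge0 andbT; apply: contraNneq alk1 => /eqP.
  rewrite mulf_eq0 [_%:R == 0]pnatr_eq0 -[_ == 0%N]negbK -lt0n.
  by rewrite fact_gt0 orbF => /eqP /nu_supp nu0; rewrite /al nu0 mul0r.
rewrite -(ler_pM2l alk).
have h1 := ler_wpM2l (al_ge0 n) lc1; have h2 := ler_wpM2r (al_ge0 k.+1) IHd.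
lra.
Qed.

(** The birth rate [(n+1) nu(n+1) / nu(n)] is largest at zero, by [al_lc] from [0]. *)
Let nuS_le n : n.+1%:R * nu n.+1 <= nu 1 / nu 0 * nu n.
Proof.
have := al_lc (leq0n n); rewrite /al fact0 mulr1 factS natrM.
have f0 : 0 < n`!%:R :> R by rewrite ltr0n fact_gt0.
rewrite !mulr1 => h; rewrite mulrAC ler_pdivlMr// -(ler_pM2r f0); lra.
Qed.

Lemma went_widen (L M : nat) (m f : nat -> R) : (L <= M)%N ->
  (forall n, (L < n)%N -> m n = 0) ->
  went (fun n : 'I_M.+1 => m n) (fun n => f n) =
  went (fun n : 'I_L.+1 => m n) (fun n => f n).
Proof.
move=> LM mL.
have E (h : nat -> R) : \sum_(n < M.+1) m n * h n = \sum_(n < L.+1) m n * h n.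
  rewrite [RHS](big_ord_widen M.+1 (fun n => m n * h n))// [RHS]big_mkcond/=.
  by apply: eq_bigr => n _; case: ltnP => // Ln; rewrite mL// mul0r.
have E1 : \sum_(n < M.+1) m n = \sum_(n < L.+1) m n.
  have := E (fun=> 1); under eq_bigr do rewrite mulr1.
  by under [in RHS]eq_bigr do rewrite mulr1.
rewrite /went /avg E1 E.
exact: (E (fun n => f n * ln (f n / _))).
Qed.

(** Equal to [C(M, n) n! / M^n], the correction in the Poisson limit of binomial weights; it tends
    to one as [M] grows. *)
Let theta M n : R := (M ^_ n)%:R / M%:R ^+ n.

Let thetaS M n : (n < M)%N -> theta M n.+1 = theta M n * (1 - n%:R / M%:R).
Proof.
move=> nM; have M0 : M%:R != 0 :> R by rewrite pnatr_eq0 -lt0n (leq_trans _ nM).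
rewrite /theta ffactnSr natrM natrB 1?ltnW// exprS; field.
by rewrite M0 expf_neq0.
Qed.

Let theta_le1 M n : (0 < M)%N -> theta M n <= 1.
Proof.
move=> M0; have MR : 0 < M%:R :> R by rewrite ltr0n.
rewrite ler_pdivrMr ?exprn_gt0// mul1r -natrX ler_nat.
elim: n => [|n IHn]; first by rewrite ffactn0 expn0.
by rewrite ffactnSr expnSr leq_mul// leq_subr.
Qed.

Let theta_ge M n : (n <= M)%N -> (0 < M)%N -> 1 - n%:R ^+ 2 / M%:R <= theta M n.
Proof.
move=> + M0; have MR : 0 < M%:R :> R by rewrite ltr0n.
elim: n => [_|n IHn nM].
  by rewrite expr0n/= mul0r subr0 /theta ffactn0 expr0 divr1.
have := IHn (ltnW nM); rewrite thetaS//.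
have -> : n.+1%:R ^+ 2 / M%:R = n%:R ^+ 2 / M%:R + n%:R / M%:R + n.+1%:R / M%:R :> R.
  by rewrite -natr1; field; rewrite gt_eqF.
have n0 : 0 <= n%:R / M%:R :> R by rewrite divr_ge0.
have n1 : 0 <= n.+1%:R / M%:R :> R by rewrite divr_ge0.
have n2 : 0 <= n%:R ^+ 2 / M%:R :> R by rewrite divr_ge0 ?exprn_ge0.
have n3 : n%:R / M%:R <= 1 :> R by rewrite ler_pdivrMr// mul1r ler_nat ltnW.
by move: (theta M n) => t; nra.
Qed.

(** [went_binomial] for [a n = al n / M^n] cut off above [L], which stays log-concave; the weights
    become [nu n * theta M n]. Then [theta <= 1] and [nuS_le] replace the birth rate by
    [nu 1 / nu 0]. *)
Let went_truncated (L M : nat) (f : nat -> R) : (L <= M)%N -> (0 < M)%N ->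
  (forall n, 0 < f n) ->
  went (fun n : 'I_L.+1 => nu n * theta M n) (fun n => f n) <=
  nu 1 / nu 0 * \sum_(n < L) nu n * ((f n.+1 - f n) * ln (f n.+1 / f n)).
Proof.
move=> LM M0 f0; have MR : 0 < M%:R :> R by rewrite ltr0n.
pose a n := if (n <= L)%N then al n / M%:R ^+ n else 0.
have aE n : 'C(M, n)%:R * a n = if (n <= L)%N then nu n * theta M n else 0.
  rewrite /a; case: leqP => _; last by rewrite mulr0.
  by rewrite /al /theta -bin_ffact natrM; ring.
have a_ge0 n : 0 <= a n.
  by rewrite /a; case: leqP => // _; rewrite divr_ge0 ?exprn_ge0.
have a_lc n m : (n <= m)%N -> a n * a m.+1 <= a n.+1 * a m.
  move=> nm; rewrite /a; case: (leqP m.+1 L) => [mL|_]; last first.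
    rewrite mulr0 mulr_ge0//; case: leqP => // _; rewrite divr_ge0 ?exprn_ge0//.
  have nL : (n < L)%N by exact: leq_ltn_trans nm mL.
  rewrite nL (ltnW nL) (ltnW mL).
  rewrite !mulf_div -!exprD addnS addSn.
  by rewrite ler_wpM2r ?invr_ge0 ?exprn_ge0// al_lc.
have a00 : 0 < a 0 by rewrite /a/= expr0 divr1 /al mulr1.
have := went_binomial M a_ge0 a00 a_lc f0.
rewrite (@went_widen L M (fun n => 'C(M, n)%:R * a n))//; last first.
  by move=> n Ln; rewrite aE leqNgt Ln.
under [X in went X _]eq_fun do rewrite aE -ltnS ltn_ord.
move=> /le_trans; apply.
rewrite mulr_sumr.
rewrite (big_ord_widen M (fun n => nu 1 / nu 0 * (nu n * ((f n.+1 - f n) * ln (f n.+1 / f n)))))//.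
rewrite [leRHS]big_mkcond/=; apply: ler_sum => n _.
rewrite mulrA -[_ * _ * a _]mulrA aE; case: ifP => nL; last by rewrite mulr0 mul0r.
have b0 : 0 <= bregman (f n.+1) (f n) by rewrite bregman_ge0// ltW.
apply: (@le_trans _ _ (nu 1 / nu 0 * nu n * bregman (f n.+1) (f n))).
  rewrite ler_wpM2r// (le_trans _ (nuS_le n))// ler_wpM2l//.
  by rewrite ler_piMr// theta_le1.
rewrite mulrA ler_wpM2l ?bregman_le_mulrB_ln//.
by rewrite !mulr_ge0// invr_ge0.
Qed.

(** For [n <= L] one has [theta M n >= 1 - L^2 / M], so comparing weights gives
    [(1 - L^2 / M) * E <= Q]; then [M] tends to infinity. *)
Lemma mlsi_ultra_log_concave (L : nat) (f : nat -> R) : (forall n, 0 < f n) ->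
  went (fun n : 'I_L.+1 => nu n) (fun n => f n) <=
  nu 1 / nu 0 * \sum_(n < L) nu n * ((f n.+1 - f n) * ln (f n.+1 / f n)).
Proof.
move=> f0; set E := went _ _; set Q := _ * _.
have nuL0 : 0 < \sum_(n < L.+1) nu n.
  by rewrite big_ord_recl/= ltr_pwDl// sumr_ge0.
have key M : (L ^ 2 < M)%N -> (1 - L%:R ^+ 2 / M%:R) * E <= Q.
  move=> LM; have M0 : (0 < M)%N by rewrite (leq_trans _ LM).
  have LM' : (L <= M)%N.
    by case: L LM {E Q nuL0} => // L LM; rewrite (leq_trans _ (ltnW LM))// expnS leq_pmulr// expn_gt0.
  have MR : 0 < M%:R :> R by rewrite ltr0n.
  have c0 : 0 < 1 - L%:R ^+ 2 / M%:R :> R.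
    by rewrite subr_gt0 ltr_pdivrMr// mul1r -natrX ltr_nat.
  rewrite (le_trans _ (went_truncated LM' M0 f0))// mulrC -ler_pdivlMr// mulrC.
  have th (n : 'I_L.+1) : 1 - L%:R ^+ 2 / M%:R <= theta M n.
    have nL : (n <= L)%N by rewrite -ltnS.
    rewrite (le_trans _ (theta_ge (leq_trans nL LM') M0))// lerD2l lerN2.
    by rewrite ler_pM2r ?invr_gt0// ler_sqr ?nnegrE// ler_nat.
  have th0 (n : 'I_L.+1) : 0 <= theta M n by rewrite (le_trans (ltW c0)).
  apply: went_le_scale => // [n||n].
  - by rewrite mulr_ge0.
  - rewrite big_ord_recl; apply: ltr_pwDl.
      by rewrite mulr_gt0// (lt_le_trans c0 (th ord0)).
    by apply: sumr_ge0 => n _; rewrite mulr_ge0.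
  - by rewrite mulrCA ler_peMr// ler_pdivlMl// mulr1.
rewrite leNgt; apply/negP => QE.
have E0 : 0 <= E by apply: went_ge0.
have d0 : 0 < E - Q by rewrite subr_gt0.
(* Chosen so that [L^2 E / M < E - Q], and [M > L^2] as [key] requires. *)
pose M := (Num.truncn (L%:R ^+ 2 * E / (E - Q)) + L ^ 2).+1.
have MR : 0 < M%:R :> R by rewrite ltr0n.
have := key M; rewrite ltnS leq_addl => /(_ isT).
suff : L%:R ^+ 2 / M%:R * E < E - Q by lra.
rewrite mulrAC ltr_pdivrMr// [ltRHS]mulrC -ltr_pdivrMr//.
by rewrite (lt_le_trans (truncnS_gt _))// ler_nat ltnS leq_addr.
Qed.

End UltraLogConcave.

(** * Bounded perturbation and the conditional laws of a box *)

Section KernelMlsi.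
Context {R : realType}.
Variable nu : nat -> R.
Hypothesis nu_ge0 : forall n, 0 <= nu n.
Hypothesis nu_gt0 : 0 < nu 0.
Hypothesis nu_supp : forall n, nu n = 0 -> nu n.+1 = 0.
Hypothesis nu_ulc : forall n, (1 <= n)%N ->
  n.+1%:R / n%:R * nu n.+1 * nu n.-1 <= nu n ^+ 2.

(** Both sides are compared with the weights [c * expR (psi j) * nu n] at the maximum [psi j]: this
    is free for the entropy and costs [expR o] for the Dirichlet sum, so the oscillation is paid
    only once. *)
Lemma mlsi_perturbed (L : nat) (c o : R) (psi f : nat -> R) :
  0 < c -> (forall n m, psi n <= psi m + o) -> (forall n, 0 < f n) ->
  went (fun n : 'I_L.+1 => c * (nu n * expR (psi n))) (fun n => f n) <=
  nu 1 / nu 0 * expR o *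
    \sum_(n < L.+1) c * (nu n * expR (psi n)) * ((f n.+1 - f n) * ln (f n.+1 / f n)).
Proof.
move=> c0 osc f0.
have D0 n : 0 <= (f n.+1 - f n) * ln (f n.+1 / f n) by exact: mulrB_ln_div_ge0.
have k0 n : 0 <= c * (nu n * expR (psi n)).
  by rewrite mulr_ge0 ?(ltW c0)// mulr_ge0// expR_ge0.
have [j _ jmax] := @Order.TotalTheory.arg_maxP _ R 'I_L.+1 ord0 predT (fun n => psi n) isT.
have nuL0 : 0 < \sum_(n < L.+1) nu n.
  by rewrite big_ord_recl/= ltr_pwDl// sumr_ge0.
have le1 : went (fun n : 'I_L.+1 => c * (nu n * expR (psi n))) (fun n => f n) <=
    c * expR (psi j) * went (fun n : 'I_L.+1 => nu n) (fun n => f n).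
  apply: went_le_scale => // [|n].
    by rewrite big_ord_recl/= ltr_pwDl ?sumr_ge0// mulr_gt0// mulr_gt0// expR_gt0.
  rewrite -mulrA ler_pM2l// mulrC ler_wpM2r// ler_expR; exact: jmax.
rewrite (le_trans le1)//.
rewrite (le_trans (ler_wpM2l _ (mlsi_ultra_log_concave nu_ge0 nu_gt0 nu_supp nu_ulc L f0)))//.
  by rewrite mulr_ge0 ?expR_ge0 ?ltW.
(* The right-hand sum also contains [n = L], a step out of the box, with a nonnegative term. *)
rewrite mulrCA -mulrA ler_wpM2l ?divr_ge0// !mulr_sumr big_ord_recr/= ler_wpDr//.
  by rewrite mulr_ge0 ?expR_ge0// mulr_ge0.
apply: ler_sum => n _; move: (_ * ln _) (D0 n) => d d0.
rewrite !mulrA ler_wpM2r//.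
rewrite [leRHS](_ : _ = c * (expR o * expR (psi n)) * nu n); last by ring.
by rewrite ler_wpM2r// ler_pM2l// -expRD ler_expR addrC osc.
Qed.

End KernelMlsi.

Section Box.
Variables (N L : nat).
Implicit Types (x : {ffun 'I_N -> 'I_L.+1}) (y : config N) (k : 'I_N).

Definition tuple_of_box x : config N := [tuple (x j : nat) | j < N].

Definition setc y k (n : nat) : config N :=
  [tuple if j == k then n else tnth y j | j < N].

Lemma tuple_of_box_upd x k t : tuple_of_box (upd x k t) = setc (tuple_of_box x) k t.
Proof.
apply: eq_from_tnth => j; rewrite !tnth_mktuple ffunE.
by case: eqP.
Qed.

Lemma incr_setc y k n : incr k (setc y k n) = setc y k n.+1.
Proof.
apply: eq_from_tnth => j; rewrite !tnth_mktuple.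
by case: eqP; rewrite ?addn1// addn0.
Qed.

End Box.

Section SiteMlsi.
Context {R : realType}.
Variables (nu : nat -> R) (N L : nat).
Hypothesis nu_ge0 : forall n, 0 <= nu n.
Hypothesis nu_gt0 : 0 < nu 0.
Hypothesis nu_supp : forall n, nu n = 0 -> nu n.+1 = 0.
Hypothesis nu_ulc : forall n, (1 <= n)%N ->
  n.+1%:R / n%:R * nu n.+1 * nu n.-1 <= nu n ^+ 2.
Variables (c : 'I_N -> R) (F : 'I_N -> nat -> R) (V : config N -> R) (o : R).
Hypothesis c_gt0 : forall k, 0 < c k.
Hypothesis osc : forall k y n m,
  F k n + V (setc y k n) <= F k m + V (setc y k m) + o.

Let p i (t : 'I_L.+1) := c i * (nu t * expR (F i t)).
Let V' (x : {ffun 'I_N -> 'I_L.+1}) := V (tuple_of_box x).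

(** Along a fibre the kernel is [c k * (nu n * expR (psi n))], where [psi] collects [F k] and [V];
    [osc] bounds its oscillation. *)
Lemma siteent_mlsi (k : 'I_N) (f : config N -> R) : (forall y, 0 < f y) ->
  siteent p V' k (fun x => f (tuple_of_box x)) <=
  nu 1 / nu 0 * expR o * \sum_(x : {ffun 'I_N -> 'I_L.+1}) gibbsw p V' x *
    ((f (incr k (tuple_of_box x)) - f (tuple_of_box x)) *
     ln (f (incr k (tuple_of_box x)) / f (tuple_of_box x))).
Proof.
move=> f0.
have p0 i t : 0 <= p i t.
  by rewrite mulr_ge0 ?mulr_ge0 ?expR_ge0// ltW.
have px0 i : 0 < p i ([ffun=> ord0] i).
  by rewrite ffunE !mulr_gt0 ?expR_gt0.
rewrite -(ler_pM2l (@card_site_gt0 R 'I_N 'I_L.+1 [ffun=> ord0] k)) siteentE//.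
rewrite [leRHS]mulrCA (sum_gibbsw p V' k (fun x => (f (incr k (tuple_of_box x)) -
  f (tuple_of_box x)) * ln (f (incr k (tuple_of_box x)) / f (tuple_of_box x)))).
rewrite mulr_sumr; apply: ler_sum => x _.
rewrite [leRHS]mulrCA ler_wpM2l ?restw_ge0//.
pose y := tuple_of_box x; pose psi n := F k n + V (setc y k n).
have kE (t : 'I_L.+1) : kernw p V' k x t = c k * (nu t * expR (psi t)).
  by rewrite /kernw /p /V' tuple_of_box_upd /psi expRD; ring.
have -> : kernw p V' k x = fun t => c k * (nu t * expR (psi t)).
  by apply/funext => t; rewrite kE.
have -> : (fun t => f (tuple_of_box (upd x k t))) = (fun t => f (setc y k t)).
  by apply/funext => t; rewrite tuple_of_box_upd.
under [X in _ * X]eq_bigr do rewrite tuple_of_box_upd incr_setc.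
exact: (mlsi_perturbed nu_ge0 nu_gt0 nu_supp nu_ulc L (c_gt0 k) (osc k y)
  (fun n => f0 (setc y k n))).
Qed.

End SiteMlsi.

(** * From finite boxes to the configuration space *)

Section Discrete.
Context {R : realType} {N : nat}.
Implicit Types (y z : config N) (A : set (config N)).

Lemma config_measurable A : measurable A.
Proof.
apply: countable_measurable => [y|]; last exact: countableP.
have -> : [set y] = \bigcap_(i in [set: 'I_N]) ((fun z : config N => tnth z i) @^-1` [set tnth y i]).
  apply/seteqP; split => [z -> //|z h].
  by apply: eq_from_tnth => i; exact: h.
apply: fin_bigcap_measurable => // i _; rewrite -[X in measurable X]setTI.
exact: measurable_tnth.
Qed.

Lemma config_measurable_fun d (U : sigmaRingType d) A (g : config N -> U) :
  measurable_fun A g.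
Proof. by move=> _ Y _; exact: config_measurable. Qed.

Definition box (L : nat) : set (config N) :=
  [set y | forall j, (tnth y j <= L)%N].

Lemma tuple_of_box_inj L : injective (@tuple_of_box N L).
Proof.
move=> x x' /(congr1 (fun y j => tnth y j)) e; apply/ffunP => j; apply/val_inj.
by have := congr1 (@^~ j) e; rewrite !tnth_mktuple.
Qed.

Lemma box_preimage L y : box L y -> exists x, y = @tuple_of_box N L x.
Proof.
move=> yL; exists [ffun j => inord (tnth y j)].
by apply: eq_from_tnth => j; rewrite tnth_mktuple ffunE inordK// ltnS.
Qed.

Lemma box_tuple_of_box L x : box L (@tuple_of_box N L x).
Proof. by move=> j; rewrite tnth_mktuple -ltnS. Qed.

Lemma nondecreasing_box : {homo box : n m / (n <= m)%N >-> (n <= m)%O}.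
Proof.
by move=> n m nm; apply/subsetPset => y yn j; rewrite (leq_trans (yn j)).
Qed.

Lemma bigcup_box : \bigcup_L box L = [set: config N].
Proof.
apply/seteqP; split => // y _; exists (\max_(j < N) tnth y j)%N => // j.
exact: (leq_bigmax j).
Qed.

Variables (mu : probability (config N) R) (u : config N -> R).
Hypothesis mu_set1 : forall y, mu [set y] = (u y)%:E.

Lemma point_mass_ge0 y : 0 <= u y.
Proof. by rewrite -lee_fin -mu_set1 measure_ge0. Qed.

Lemma integral_config_set1 y (g : config N -> \bar R) :
  (\int[mu]_(z in [set y]) g z = g y * (u y)%:E)%E.
Proof.
rewrite (eq_integral (cst (g y))); last by move=> z; rewrite inE => ->.
rewrite integral_cst; last exact: config_measurable.
by congr (_ * _)%E; exact: mu_set1.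
Qed.

Lemma integral_finite (I : finType) (P : pred I) (h : I -> config N)
    (g : config N -> \bar R) :
  injective h -> (forall y, (0 <= g y)%E) ->
  (\int[mu]_(y in [set h i | i in [set i | P i]]) g y =
   \sum_(i | P i) g (h i) * (u (h i))%:E)%E.
Proof.
move=> h_inj g0.
have -> : [set h i | i in [set i | P i]] =
    \big[setU/set0]_(i <- enum P) [set h i].
  rewrite -bigcup_seq; apply/seteqP; split => [y [i Pi <-]|y [i]].
    by exists i => //=; rewrite mem_enum.
  by rewrite /= mem_enum => Pi ->; exists i.
rewrite ge0_integral_bigsetU//=.
- by rewrite big_enum/=; apply: eq_bigr => i _; exact: integral_config_set1.
- by move=> i; exact: config_measurable.
- exact: enum_uniq.
- by move=> i j _ _ [y [-> /h_inj]].
- exact: config_measurable_fun.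
Qed.

Lemma integral_box L (g : config N -> \bar R) : (forall y, (0 <= g y)%E) ->
  (\int[mu]_(y in box L) g y = \sum_(x : {ffun 'I_N -> 'I_L.+1})
    g (tuple_of_box x) * (u (tuple_of_box x))%:E)%E.
Proof.
move=> g0; rewrite -(@integral_finite _ predT _ _ (@tuple_of_box_inj L))//.
congr integral; apply/seteqP; split => [y /box_preimage[x ->]|_ [x _ <-]].
  by exists x.
exact: box_tuple_of_box.
Qed.

Lemma cvg_integral_box (g : config N -> \bar R) : (forall y, (0 <= g y)%E) ->
  (\int[mu]_(y in box L) g y @[L --> \oo] --> \int[mu]_y g y)%E.
Proof.
move=> g0; rewrite -bigcup_box; apply: ge0_nondecreasing_set_cvg_integral => //.
- exact: nondecreasing_box.
- by move=> i; exact: config_measurable.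
- by move=> i; exact: config_measurable_fun.
Qed.

End Discrete.

(** * Entropy bounds in the limit of growing boxes *)

Section EntropyLimit.
Context {R : realType}.

Lemma xlnx_ge a : 0 <= a -> a - 1 <= a * ln a :> R.
Proof. by move=> a0; have := bregman_ge0 a0 (@ltr01 R); rewrite /bregman divr1; lra. Qed.

Lemma xlnx_superadditive a d : 0 <= a -> 0 < d ->
  a * ln a + d * ln d <= (a + d) * ln (a + d) :> R.
Proof.
move=> a0 d0; have [->|aN0] := eqVneq a 0; first by rewrite mul0r !add0r.
have a_gt0 : 0 < a by rewrite lt0r aN0.
rewrite mulrDl lerD// ler_pM2l// ler_ln ?posrE ?addr_gt0//; lra.
Qed.

Lemma sqr_xlnx_ge e : 0 < e -> - (2 * e) <= e ^+ 2 * ln (e ^+ 2) :> R.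
Proof.
move=> e0; rewrite lnXn//.
have := @ln_le_subr1 R e^-1; rewrite invr_gt0 lnV ?posrE// => /(_ e0).
rewrite -(ler_pM2l e0) mulrBr mulfV ?gt_eqF// mulr1 mulrN => h.
rewrite -[_ *+ 2]mulr_natl; nra.
Qed.

(** The limit [d -> 0], made quantitative: with [d = e^2] the singular term [d ln d] is at least
    [- 2 e], and for [e <= 1] the whole error is at most a constant [K] times [e]. *)
Lemma went_shift_limit (T : finType) (m f : T -> R) (r : R) :
  (forall t, 0 <= m t) -> 0 < \sum_t m t -> (forall t, 0 <= f t) ->
  (forall d, 0 < d -> went m (fun t => f t + d) <= r) ->
  \sum_t m t * (f t * ln (f t)) <=
    r + (\sum_t m t * f t) * ln ((\sum_t m t * f t) / \sum_t m t).
Proof.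
move=> m0 U0 f0 wr; set S := \sum_t m t * f t; set U := \sum_t m t in U0 *.
set H := \sum_t _.
have S0 : 0 <= S by apply: sumr_ge0 => t _; rewrite mulr_ge0.
have r0 : 0 <= r.
  by rewrite (le_trans _ (wr 1 ltr01))// went_ge0// => t; rewrite ltr_wpDl.
have [SE|SN0] := eqVneq S 0.
  rewrite SE mul0r addr0 /H big1// => t _; rewrite mulrA.
  suff -> : m t * f t = 0 by rewrite mul0r.
  have /psumr_eq0P := SE; apply => // i _; by rewrite mulr_ge0.
have S_gt0 : 0 < S by rewrite lt0r SN0.
have bound e : 0 < e -> e <= 1 ->
    H <= r + S * ln (S / U) + e * (U * `|ln (S / U)| + U + U ^+ 2 / S + 2 * U).
  move=> e0 e1; pose d := e ^+ 2; have d0 : 0 < d by rewrite exprn_gt0.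
  have fd t : 0 < f t + d by rewrite ltr_wpDl.
  have SdE : \sum_t m t * (f t + d) = S + d * U.
    by under eq_bigr do rewrite mulrDr; rewrite big_split/= -mulr_suml [U * d]mulrC.
  have SU0 : 0 < S / U by rewrite divr_gt0.
  have Sd0 : 0 < S + d * U by rewrite addr_gt0// mulr_gt0.
  have := wr d d0; rewrite /went /avg SdE -/U => wd.
  have H1 : H + U * (d * ln d) <= \sum_t m t * ((f t + d) * ln (f t + d)).
    rewrite /U mulr_suml -big_split/=; apply: ler_sum => t _.
    by rewrite -mulrDr ler_wpM2l// xlnx_superadditive.
  have H2 : \sum_t m t * ((f t + d) * ln (f t + d)) =
    \sum_t m t * ((f t + d) * ln ((f t + d) / ((S + d * U) / U))) +
      (S + d * U) * ln ((S + d * U) / U).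
    rewrite -{2}SdE mulr_suml -big_split/=; apply: eq_bigr => t _.
    rewrite -mulrA -!mulrDr; congr (_ * (_ * _)).
    by rewrite [ln (_ / (_ / U))]ln_div ?posrE ?divr_gt0// subrK.
  have H3 : ln ((S + d * U) / U) <= ln (S / U) + d * U / S.
    have -> : (S + d * U) / U = S / U * (1 + d * U / S).
      by field; rewrite !gt_eqF.
    rewrite lnM ?posrE//; last by rewrite addr_gt0// divr_gt0// mulr_gt0.
    rewrite lerD2l le_ln1Dx// (lt_trans (@ltrN10 R))// divr_gt0// mulr_gt0//.
  have H4 := ler_wpM2l (ltW Sd0) H3.
  have H5 := ler_wpM2l (ltW U0) (sqr_xlnx_ge e0); rewrite -/d in H5.
  have H6 : H <= r + (S + d * U) * (ln (S / U) + d * U / S) + 2 * e * U by lra.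
  rewrite (le_trans H6)//.
  have -> : (S + d * U) * (ln (S / U) + d * U / S) =
      S * ln (S / U) + (d * U * ln (S / U) + d * U + d * (d * (U ^+ 2 / S))).
    by field; rewrite !gt_eqF.
  have de : d <= e by rewrite /d expr2 ler_piMl// ltW.
  have d1 : d <= 1 by rewrite (le_trans de).
  have l1 := ler_norm (ln (S / U)); have US : 0 <= U ^+ 2 / S by rewrite divr_ge0 ?sqr_ge0.
  have dU : 0 <= d * U by rewrite mulr_ge0 ?ltW.
  have k1 := ler_wpM2l dU l1.
  have k2 : d * U * `|ln (S / U)| <= e * (U * `|ln (S / U)|).
    by rewrite -mulrA ler_wpM2r// mulr_ge0// ltW.
  have k3 : d * U <= e * U by rewrite ler_pM2r.
  have k4 : d * (d * (U ^+ 2 / S)) <= e * (U ^+ 2 / S).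
    have dUS : d * (U ^+ 2 / S) <= U ^+ 2 / S by rewrite ler_piMl.
    by apply: ler_pM => //; [exact: ltW | rewrite mulr_ge0// ltW].
  by rewrite !mulrDr; lra.
set K := _ + _ + _ + _ in bound.
have K0 : 0 < K.
  rewrite ltr_wpDl ?mulr_gt0// !addr_ge0 ?mulr_ge0 ?(ltW U0)// ?exprn_ge0 ?(ltW U0)//.
  by rewrite invr_ge0.
apply/ler_addgt0Pr => e e0.
pose e' := Num.min 1 (e / K).
have e'0 : 0 < e' by rewrite lt_min ltr01 divr_gt0.
rewrite (le_trans (bound e' e'0 _)) ?ge_min ?lexx// lerD2l.
by rewrite -ler_pdivlMr// ge_min lexx orbT.
Qed.

Variables (N : nat) (mu : probability (config N) R) (u f : config N -> R).
Hypothesis mu_set1 : forall y, mu [set y] = (u y)%:E.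
Hypothesis f_ge0 : forall y, 0 <= f y.
Variables (y0 : config N) (L0 : nat) (r : R).
Hypothesis y0_box : box L0 y0.
Hypothesis u_y0 : 0 < u y0.
Hypothesis went_le : forall L (d : R), (L0 <= L)%N -> 0 < d ->
  went (fun x : {ffun 'I_N -> 'I_L.+1} => u (tuple_of_box x))
       (fun x => f (tuple_of_box x) + d) <= r.

Let U L := \sum_(x : {ffun 'I_N -> 'I_L.+1}) u (tuple_of_box x).
Let S L := \sum_(x : {ffun 'I_N -> 'I_L.+1}) u (tuple_of_box x) * f (tuple_of_box x).
Let H L := \sum_(x : {ffun 'I_N -> 'I_L.+1})
  u (tuple_of_box x) * (f (tuple_of_box x) * ln (f (tuple_of_box x))).
Let u_ge0 y : 0 <= u y. Proof. exact: (point_mass_ge0 mu_set1). Qed.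

Let integral_box_EFin L (g : config N -> R) : (forall y, 0 <= g y) ->
  (\int[mu]_(y in box L) (g y)%:E = (\sum_(x : {ffun 'I_N -> 'I_L.+1})
    u (tuple_of_box x) * g (tuple_of_box x))%:E)%E.
Proof.
move=> g0; rewrite (integral_box mu_set1); last by move=> y; rewrite lee_fin.
by rewrite -sumEFin; apply: eq_bigr => x _; rewrite -EFinM mulrC.
Qed.

Let cvgU : U L @[L --> \oo] --> (1 : R).
Proof.
have := @cvg_integral_box R N mu (cst 1%:E) (fun=> lee01).
rewrite integral_cst//= probability_setT mul1e.
have -> : (fun L => \int[mu]_(y in box L) cst 1%:E y)%E = (fun L => (U L)%:E).
  apply/funext => L; rewrite (@integral_box_EFin L (cst 1))//=.
  by under eq_bigr do rewrite mulr1.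
by move/fine_cvgP => [].
Qed.

Let U_gt0 L : (L0 <= L)%N -> 0 < U L.
Proof.
move=> L0L; have yL : box L y0 by move=> j; rewrite (leq_trans (y0_box j)).
have [x xE] := box_preimage yL.
rewrite /U (bigD1 x)//= ltr_pwDl -?xE ?sumr_ge0// => i _; exact: u_ge0.
Qed.

Let U_le1 L : U L <= 1.
Proof.
have := @ge0_subset_integral _ _ _ mu _ _ (config_measurable (box L))
  (@config_measurable N setT) (cst 1%:E) (config_measurable_fun _) (fun _ _ => lee01) (@subsetT _ _).
rewrite (@integral_box_EFin L (cst 1))//= integral_cst//= probability_setT mul1e lee_fin.
by under eq_bigr do rewrite mulr1.
Qed.

Let H_le L : (L0 <= L)%N -> H L <= r + S L * ln (S L / U L).
Proof.
move=> L0L; apply: went_shift_limit => //; last by move=> d; exact: went_le.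
exact: U_gt0.
Qed.

Let S_ge0 L : 0 <= S L.
Proof. by apply: sumr_ge0 => x _; rewrite mulr_ge0. Qed.

(* A large mean would make the entropy density at [y0] alone exceed [r]. *)
Let S_bounded L : (L0 <= L)%N -> S L <= 2 * (r / u y0 + f y0 * ln 2).
Proof.
move=> L0L; have UL := U_gt0 L0L.
have r0 : 0 <= r.
  rewrite (le_trans _ (went_le (leqnn L0) (@ltr01 R)))// went_ge0//.
    exact: U_gt0.
  by move=> x; rewrite ltr_wpDl.
have [S0|SN0] := eqVneq (S L) 0.
  by rewrite S0 mulr_ge0// addr_ge0 ?divr_ge0 ?(ltW u_y0)// mulr_ge0// ln_ge0// ler1n.
have S_gt0 : 0 < S L by rewrite lt0r SN0 S_ge0.
pose s := S L / U L; have s0 : 0 < s by rewrite divr_gt0.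
(* The entropy based at the box mean [s] has nonnegative summands, so the one at [y0] is at most
   [r]; the linear minorant with slope [1/2] then bounds [s]. *)
have breg : \sum_(x : {ffun 'I_N -> 'I_L.+1}) u (tuple_of_box x) *
    bregman (f (tuple_of_box x)) s <= r.
  have := H_le L0L; rewrite -/s -lerBlDr; apply: le_trans.
  rewrite le_eqVlt; apply/orP; left; apply/eqP.
  transitivity (H L - ln s * S L - S L + s * U L); last first.
    by rewrite /s divfK ?gt_eqF//; ring.
  rewrite /H /S /U !mulr_sumr -!sumrB -big_split/=; apply: eq_bigr => x _.
  rewrite /bregman; have [->|fN0] := eqVneq (f (tuple_of_box x)) 0; first by ring.
  by rewrite ln_div ?posrE// ?lt0r ?fN0 ?f_ge0//; ring.
have yL : box L y0 by move=> j; rewrite (leq_trans (y0_box j)).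
have [x xE] := box_preimage yL.
have breg0 : u y0 * bregman (f y0) s <= r.
  rewrite (le_trans _ breg)// (bigD1 x)//= -xE lerDl sumr_ge0// => i _.
  by rewrite mulr_ge0// bregman_ge0.
have h2 : 0 < 2^-1 :> R by rewrite invr_gt0.
have lin := bregman_ge_linear s0 (f_ge0 y0) h2.
rewrite lnV ?posrE// in lin.
have : bregman (f y0) s <= r / u y0 by rewrite ler_pdivlMr// mulrC.
have Ss : S L <= s by rewrite ler_pdivlMr// ler_piMr.
lra.
Qed.

(** [S_bounded] makes the mean [s] finite; then [H_le] passes to the limit, where [U L] tends to one
    and [S L] to [s]. *)
Lemma Ent_le_of_box : (Ent mu f <= r%:E)%E.
Proof.
have cvS := @cvg_integral_box R N mu (fun y => (f y)%:E) (fun y => f_ge0 y).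
have ES : (fun L => \int[mu]_(y in box L) (f y)%:E)%E = (fun L => (S L)%:E).
  by apply/funext => L; rewrite integral_box_EFin.
rewrite ES in cvS.
have int_ge0 : (0 <= \int[mu]_y (f y)%:E)%E.
  by apply: integral_ge0 => y _; rewrite lee_fin.
have S_le L : ((S L)%:E <= \int[mu]_y (f y)%:E)%E.
  have -> : (S L)%:E = (\int[mu]_(y in box L) (f y)%:E)%E by rewrite integral_box_EFin.
  apply: ge0_subset_integral => //; try exact: config_measurable.
  - exact: config_measurable_fun.
  - by move=> y _; rewrite lee_fin.
have int_fin : (\int[mu]_y (f y)%:E)%E \is a fin_num.
  rewrite ge0_fin_numE// (@le_lt_trans _ _ (2 * (r / u y0 + f y0 * ln 2))%:E) ?ltry//.
  rewrite -(cvg_lim _ cvS)//; apply: lime_le; first by apply/cvg_ex; eexists; exact: cvS.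
  by exists L0 => // L /= L0L; rewrite lee_fin S_bounded.
set s := fine (\int[mu]_y (f y)%:E)%E.
have sE : (\int[mu]_y (f y)%:E)%E = s%:E by rewrite fineK.
have S_les L : S L <= s by rewrite -lee_fin -sE.
rewrite sE in cvS int_ge0.
have s_ge0 : 0 <= s by rewrite -lee_fin.
have {}cvS : S L @[L --> \oo] --> s by move/fine_cvgP: cvS => [].
(* Adding one makes [f ln f] nonnegative, as monotone convergence requires; the constant is
   subtracted again in [EH]. *)
pose g y := f y * ln (f y) + 1.
have g0 y : 0 <= g y by rewrite /g; have := xlnx_ge (f_ge0 y); have := f_ge0 y; lra.
have cvg := @cvg_integral_box R N mu (fun y => (g y)%:E) (fun y => g0 y).
have Eg : (fun L => \int[mu]_(y in box L) (g y)%:E)%E = (fun L => (H L + U L)%:E).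
  apply/funext => L; rewrite integral_box_EFin//; congr EFin.
  by rewrite /H /U -big_split/=; apply: eq_bigr => x _; rewrite /g mulrDr mulr1.
rewrite Eg in cvg.
have int_g : (\int[mu]_y (g y)%:E <= (r + s * ln s + 1)%:E)%E.
  (* A zero mean is separate, since the logarithm is not continuous at zero. *)
  have [s0|sN0] := eqVneq s 0.
    rewrite -(cvg_lim _ cvg)//; apply: lime_le; first by apply/cvg_ex; eexists; exact: cvg.
    exists L0 => // L /= L0L; rewrite lee_fin lerD// (le_trans (H_le L0L))//.
    have -> : S L = 0.
      by apply/eqP; rewrite eq_le S_ge0 andbT -s0.
    by rewrite s0 !mul0r.
  have s_gt0 : 0 < s by rewrite lt0r sN0.
  have cvR : (r + S L * ln (S L / U L) + U L) @[L --> \oo] --> r + s * ln (s / 1) + 1.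
    apply: cvgD => //; apply: cvgD; first exact: cvg_cst.
    apply: cvgM => //; apply: continuous_cvg.
      by apply: continuous_ln; rewrite divr1.
    by apply: cvgM => //; apply: cvgV.
  rewrite divr1 in cvR.
  have cvRE : ((r + S L * ln (S L / U L) + U L)%:E)%E @[L --> \oo] -->
      (r + s * ln s + 1)%:E.
    by apply/fine_cvgP; split; [exact: nearW | exact: cvR].
  rewrite -(cvg_lim _ cvg)// -(cvg_lim _ cvRE)//; apply: lee_lim.
  - by apply/cvg_ex; eexists; exact: cvg.
  - by apply/cvg_ex; eexists; exact: cvRE.
  - by exists L0 => // L /= L0L; rewrite lee_fin lerD2r H_le.
have ig : mu.-integrable setT (EFin \o g).
  apply/integrableP; split; first exact: config_measurable_fun.
  under eq_integral do rewrite gee0_abs ?lee_fin//.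
  by rewrite (le_lt_trans int_g)// ltry.
have EH : ('E_mu[fun y => (f y * ln (f y))%R] = (\int[mu]_y (g y)%:E) - 1)%E.
  rewrite unlock.
  transitivity (\int[mu]_y ((g y)%:E - (cst 1 y)%:E))%E.
    by apply: eq_integral => y _; rewrite -EFinB /g addrK.
  rewrite integralB_EFin//; last exact: finite_measure_integrable_cst.
  congr (_ - _)%E; rewrite -[RHS]mul1e -[X in (_ * X)%E](probability_setT mu).
  by rewrite -(integral_cst mu measurableT 1%:E); apply: eq_integral.
rewrite /Ent /entropy EH.
have -> : ('E_mu[f] = s%:E)%E by rewrite unlock.
have gfin : (\int[mu]_y (g y)%:E)%E \is a fin_num by exact: integrable_fin_num.
move: int_g; rewrite -(fineK gfin); set G := fine _; rewrite lee_fin => Gle.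
have -> : (s%:E * lne s%:E = (s * ln s)%:E)%E.
  have [->|sN0] := eqVneq s 0; first by rewrite mul0e mul0r.
  by rewrite lne_EFin ?lt0r ?sN0.
by rewrite -EFinB -DualAddTheoryNumDomain.dEFinB lee_fin; lra.
Qed.

End EntropyLimit.

(** * The Dirichlet form restricted to a box *)

Section DirichletBox.
Context {R : realType} {N : nat}.
Variables (mu : probability (config N) R) (u f : config N -> R).
Hypothesis mu_set1 : forall y, mu [set y] = (u y)%:E.
Hypothesis f_ge0 : forall y, 0 <= f y.

(** Adding [d] to both values keeps their difference and moves their ratio towards one. If exactly
    one value is zero, the right-hand side is [+oo]; if both are, the two sides vanish. *)
Let density_ge (a b d : R) : 0 <= a -> 0 <= b -> 0 < d ->
  (((a - b) * ln ((a + d) / (b + d)))%:E <=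
   (a - b)%:E * (lne a%:E - lne b%:E))%E.
Proof.
move=> a0 b0 d0; have [->|bN0] := eqVneq b 0.
  have [->|aN0] := eqVneq a 0; first by rewrite subrr mul0r mul0e.
  have a_gt0 : 0 < a by rewrite lt0r aN0.
  rewrite lne_EFin// le0_lneNy// subr0.
  by rewrite /= addey// gt0_muley ?lte_fin// leey.
have b_gt0 : 0 < b by rewrite lt0r bN0.
have bd : 0 < b + d by rewrite addr_gt0.
have [->|aN0] := eqVneq a 0.
  rewrite [in lne 0]le0_lneNy// lne_EFin//= sub0r.
  by rewrite addNye lt0_muleNy ?leey// lte_fin oppr_lt0.
have a_gt0 : 0 < a by rewrite lt0r aN0.
have ad : 0 < a + d by rewrite addr_gt0.
rewrite !lne_EFin// -EFinB -EFinM lee_fin -ln_div ?posrE//.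
have [ab|/ltW ba] := leP b a.
  rewrite ler_wpM2l ?subr_ge0// ler_ln ?posrE ?divr_gt0//.
  by rewrite ler_pdivrMr// mulrAC ler_pdivlMr// !mulrDl !mulrDr; nra.
rewrite ler_wnM2l ?subr_le0// ler_ln ?posrE ?divr_gt0//.
by rewrite ler_pdivrMr// mulrAC ler_pdivlMr//; nra.
Qed.

Lemma dirichlet_density_ge0 k y : (0 <= dirichlet_density k f y)%E.
Proof.
apply: le_trans (density_ge (f_ge0 _) (f_ge0 _) (@ltr01 R)).
rewrite lee_fin; have a0 := f_ge0 (incr k y); have b0 := f_ge0 y.
have := @mulrB_ln_div_ge0 R (f y + 1) (f (incr k y) + 1).
have -> : f (incr k y) + 1 - (f y + 1) = f (incr k y) - f y by ring.
by apply; rewrite ltr_wpDl.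
Qed.

Lemma dirichlet_box_le k L d : 0 < d ->
  ((\sum_(x : {ffun 'I_N -> 'I_L.+1}) u (tuple_of_box x) *
     ((f (incr k (tuple_of_box x)) + d - (f (tuple_of_box x) + d)) *
      ln ((f (incr k (tuple_of_box x)) + d) / (f (tuple_of_box x) + d))))%:E <=
   \int[mu]_y dirichlet_density k f y)%E.
Proof.
move=> d0; apply: (@le_trans _ _ (\int[mu]_(y in box L) dirichlet_density k f y)%E).
  rewrite (integral_box mu_set1); last exact: dirichlet_density_ge0.
  rewrite -sumEFin; apply: lee_sum => x _; rewrite mulrC.
  have -> (a b : R) : a + d - (b + d) = a - b by ring.
  rewrite EFinM.
  by rewrite lee_wpmul2r ?lee_fin ?(point_mass_ge0 mu_set1)//; exact: density_ge.
apply: ge0_subset_integral => //; try exact: config_measurable.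
- exact: config_measurable_fun.
- by move=> y _; exact: dirichlet_density_ge0.
Qed.

End DirichletBox.

(** * Conditional entropies on whole fibres *)

Section ConditionalEntropy.
Context {R : realType} {N : nat}.
Variables (mu : probability (config N) R) (u f : config N -> R) (M : R).
Hypothesis mu_set1 : forall y, mu [set y] = (u y)%:E.
Hypothesis f_ge0 : forall y, 0 <= f y.
Hypothesis f_le : forall y, f y <= M.

Let bounded_integrable (A : set (config N)) (g : config N -> R) (B : R) :
  (forall y, `|g y| <= B) -> mu.-integrable A (EFin \o g).
Proof.
move=> gB; apply: measurable_bounded_integrable.
- exact: config_measurable.
- exact: (le_lt_trans (probability_le1 mu (config_measurable A)) (ltry _)).
- exact: config_measurable_fun.
- exists B; split; first exact: num_real.
  by move=> c Bc y _; rewrite /= (le_trans (gB y))// ltW.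
Qed.

Let integrable_f (A : set (config N)) : mu.-integrable A (EFin \o f).
Proof. by apply: (@bounded_integrable _ _ M) => y; rewrite ger0_norm. Qed.

Let integrable_flnf (A : set (config N)) :
  mu.-integrable A (EFin \o (fun y => f y * ln (f y))).
Proof.
apply: (@bounded_integrable _ _ (1 + M * M)) => y.
have f0 := f_ge0 y; have fM := f_le y.
have MM : f y * f y <= M * M by rewrite ler_pM.
have ff : 0 <= f y * f y by rewrite mulr_ge0.
rewrite ler_norml; apply/andP; split; first by have := xlnx_ge f0; lra.
have [->|fN0] := eqVneq (f y) 0; first by rewrite mul0r; nra.
have fgt0 : 0 < f y by rewrite lt0r fN0.
by have := ln_le_subr1 fgt0; rewrite -(ler_pM2l fgt0); nra.
Qed.

Let SA (A : set (config N)) := Rintegral mu A f.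
Let HA (A : set (config N)) := Rintegral mu A (fun y => f y * ln (f y)).
Let UA (A : set (config N)) := fine (mu A).

Let integrable_bregman (A : set (config N)) r : 0 < r ->
  mu.-integrable A (EFin \o (fun y => bregman (f y) r)) /\
  Rintegral mu A (fun y => bregman (f y) r) = HA A - (ln r + 1) * SA A + r * UA A.
Proof.
move=> r0.
have bE y : bregman (f y) r = f y * ln (f y) - (ln r + 1) * f y + r.
  rewrite /bregman; have [->|fN0] := eqVneq (f y) 0; first by ring.
  by rewrite ln_div ?posrE// ?lt0r ?fN0 ?f_ge0//; ring.
have mA := config_measurable A.
have i1 := integrable_flnf A; have i2 := integrable_f A.
have i3 : mu.-integrable A (EFin \o (fun y => (ln r + 1) * f y)).
  apply: (@bounded_integrable _ _ (`|ln r + 1| * M)) => y.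
  by rewrite normrM ler_wpM2l// ger0_norm.
have i4 : mu.-integrable A (EFin \o (fun _ : config N => r)).
  by apply: (@bounded_integrable _ _ `|r|).
have i5 : mu.-integrable A (EFin \o (fun y => f y * ln (f y) - (ln r + 1) * f y)).
  by have := integrableB mA i1 i3; apply: eq_integrable.
split.
  have := integrableD mA i5 i4; apply: eq_integrable => // y _.
  by rewrite /= bE.
rewrite (eq_Rintegral _ (fun y _ => bE y)).
by rewrite RintegralD// RintegralB// RintegralZl// Rintegral_cst.
Qed.

Let SA_ge0 A : 0 <= SA A. Proof. by apply: Rintegral_ge0 => y _. Qed.

(** With base point [e / UA A] the divergence integrates to [HA A + e], for every [e > 0]. *)
Let HA_ge0 A : SA A = 0 -> 0 < UA A -> 0 <= HA A.
Proof.
move=> S0 U0; rewrite -[HA A]subr0; apply/ler_addgt0Pr => e e0.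
have eU := divr_gt0 e0 U0; have [_ E] := integrable_bregman A eU.
have : 0 <= Rintegral mu A (fun y => bregman (f y) (e / UA A)).
  by apply: Rintegral_ge0 => y _; exact: bregman_ge0.
by rewrite E S0 mulr0 subr0 divfK ?gt_eqF// subr0.
Qed.

Let HA_ge A : 0 < UA A -> 0 <= HA A - SA A * ln (SA A / UA A).
Proof.
move=> U0; have [S0|SN0] := eqVneq (SA A) 0.
  by rewrite S0 mul0r subr0 HA_ge0.
have r0 : 0 < SA A / UA A by rewrite divr_gt0// lt0r SN0/=.
have [_ E] := integrable_bregman A r0.
have : 0 <= Rintegral mu A (fun y => bregman (f y) (SA A / UA A)).
  by apply: Rintegral_ge0 => y _; exact: bregman_ge0.
by rewrite E divfK ?gt_eqF//; lra.
Qed.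

Section OneFiber.
Variables (A : set (config N)) (T : finType) (m : T -> R) (c : R) (h : T -> config N).
Hypothesis m_ge0 : forall t, 0 <= m t.
Hypothesis m_gt0 : 0 < \sum_t m t.
Hypothesis c_gt0 : 0 < c.
Hypothesis h_inj : injective h.
Hypothesis h_fiber : forall t, A (h t).
Hypothesis uE : forall t, u (h t) = c * m t.

Let S := SA A.
Let H := HA A.
Let U := UA A.

Let sum_le_Rintegral (g : config N -> R) : (forall y, 0 <= g y) ->
  mu.-integrable A (EFin \o g) ->
  \sum_t c * m t * g (h t) <= Rintegral mu A g.
Proof.
move=> g0 ig; rewrite -lee_fin fineK; last exact: (integrable_fin_num (config_measurable A) ig).
have -> : (\sum_t c * m t * g (h t))%:E =
    (\int[mu]_(y in [set h t | t in [set t | predT t]]) (g y)%:E)%E.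
  rewrite (integral_finite mu_set1)//.
  by rewrite -sumEFin; apply: eq_bigr => t _; rewrite uE -EFinM mulrC.
apply: ge0_subset_integral; try exact: config_measurable.
- exact: config_measurable_fun.
- by move=> y _; rewrite lee_fin.
- by move=> _ [t _ <-].
Qed.

Let sum_bregman_le (r : R) : 0 < r ->
  \sum_t c * m t * bregman (f (h t)) r <= H - (ln r + 1) * S + r * U.
Proof.
move=> r0; have [ib <-] := integrable_bregman A r0.
by rewrite sum_le_Rintegral// => y; rewrite bregman_ge0.
Qed.

Lemma fiber_mass_gt0 : 0 < U.
Proof.
have i1 : mu.-integrable A (EFin \o cst 1).
  by apply: (@bounded_integrable _ _ 1) => y; rewrite normr1.
have := @sum_le_Rintegral (cst 1) (fun=> ler01) i1.
rewrite Rintegral_cst ?mul1r; last exact: config_measurable.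
apply: lt_le_trans; under eq_bigr do rewrite mulr1.
by rewrite -mulr_sumr mulr_gt0.
Qed.

(** The mean over all of [A], shifted by [d], serves as base point for the finite piece;
    [bregman_add] removes the shift, and nonnegativity of the divergence extends the sum to [A]. If
    [S = 0], then [f] vanishes wherever the piece has mass, and the base point [d] gives zero. *)
Lemma went_le_fiber d : 0 < d ->
  c * went m (fun t => f (h t) + d) <= H - S * ln (S / U).
Proof.
move=> d0; have fd t : 0 < f (h t) + d by rewrite ltr_wpDl.
have [S0|SN0] := eqVneq S 0.
  have H0 : 0 <= H := HA_ge0 S0 fiber_mass_gt0.
  rewrite S0 mul0r subr0 (le_trans _ H0)// -(mulr0 c) ler_pM2l//.
  rewrite (le_trans (went_le_bregman m_ge0 m_gt0 fd d0))//.
  rewrite big1// => t _.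
  have uf0 : c * m t * f (h t) = 0.
    have sum0 : \sum_t c * m t * f (h t) = 0.
      apply/eqP; rewrite eq_le; apply/andP; split.
        by rewrite -[leRHS]S0; exact: sum_le_Rintegral.
      by apply: sumr_ge0 => i _; rewrite mulr_ge0// mulr_ge0// ltW.
    have /psumr_eq0P := sum0; apply => // i _.
    by rewrite mulr_ge0// mulr_ge0// ltW.
  move/eqP: uf0; rewrite !mulf_eq0 (gt_eqF c_gt0)/= => /orP[/eqP->|/eqP->].
    by rewrite mul0r.
  by rewrite add0r /bregman divff ?gt_eqF// ln1 mulr0 sub0r addNr mulr0.
have S_gt0 : 0 < S by rewrite lt0r SN0 SA_ge0.
have r0 : 0 < S / U := divr_gt0 S_gt0 fiber_mass_gt0.
have := sum_bregman_le r0; rewrite divfK ?(gt_eqF fiber_mass_gt0)//.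
have -> : H - (ln (S / U) + 1) * S + S = H - S * ln (S / U) by ring.
apply: le_trans.
rewrite (le_trans (ler_wpM2l (ltW c_gt0)
  (went_le_bregman m_ge0 m_gt0 fd (addr_gt0 r0 d0))))// mulr_sumr.
apply: ler_sum => t _; rewrite mulrA ler_wpM2l ?mulr_ge0 ?(ltW c_gt0)//.
exact: bregman_add.
Qed.

End OneFiber.

Let xlnx_lne (x : R) : 0 <= x -> (x%:E * lne x%:E = (x * ln x)%:E)%E.
Proof.
move=> x0; have [->|xN0] := eqVneq x 0; first by rewrite mul0e mul0r.
by rewrite lne_EFin ?lt0r ?xN0.
Qed.

Let Ent_condE k y (A := fiber k y) :
  Ent_cond mu k f y = ((HA A - SA A * ln (SA A / UA A)) / UA A)%:E.
Proof.
have mA := config_measurable A.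
have Ufin : mu A \is a fin_num by exact: fin_num_measure.
have UE : mu A = (UA A)%:E by rewrite fineK.
have SE : (\int[mu]_(y in A) (f y)%:E)%E = (SA A)%:E.
  by rewrite fineK//; exact: (integrable_fin_num mA (integrable_f A)).
have HE : (\int[mu]_(y in A) (f y * ln (f y))%:E)%E = (HA A)%:E.
  by rewrite fineK//; exact: (integrable_fin_num mA (integrable_flnf A)).
rewrite /Ent_cond /entropy /condE -/A SE HE UE.
(* On a null fibre both integrals vanish, and zero times the inverse of the mass is zero on either
   side. *)
have [U0|UN0] := eqVneq (UA A) 0.
  have mA0 : mu A = 0%E by rewrite UE U0.
  have S0 : SA A = 0.
    by rewrite /SA /Rintegral null_set_integral//; exact: config_measurable_fun.
  have H0 : HA A = 0.
    by rewrite /HA /Rintegral null_set_integral//; exact: config_measurable_fun.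
  by rewrite S0 H0 !mul0e -DualAddTheoryNumDomain.dEFinB mul0r subr0 mul0r.
have U_gt0 : 0 < UA A by rewrite lt0r UN0/= fine_ge0.
rewrite inver (negbTE UN0) -!EFinM xlnx_lne ?divr_ge0 ?(ltW U_gt0) ?SA_ge0//.
by rewrite -DualAddTheoryNumDomain.dEFinB; congr EFin; rewrite mulrBl mulrAC.
Qed.

Lemma Ent_cond_ge0 k y : (0 <= Ent_cond mu k f y)%E.
Proof.
rewrite Ent_condE lee_fin; have [->|UN0] := eqVneq (UA (fiber k y)) 0.
  by rewrite invr0 mulr0.
have U_gt0 : 0 < UA (fiber k y) by rewrite lt0r UN0/= fine_ge0.
by rewrite divr_ge0 ?HA_ge ?ltW.
Qed.

Let fiber_eq (k : 'I_N) (y z : config N) : fiber k y z -> fiber k z = fiber k y.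
Proof.
move=> yz; apply/seteqP; split => t tz j jk; first by rewrite tz// yz.
by rewrite tz// yz.
Qed.

(** [Ent_cond] is constant on the fibre, so its integral is its value times the mass, which cancels
    the normalisation. *)
Lemma went_le_Ent_cond k y (T : finType) (m : T -> R) (c : R) (h : T -> config N) d :
  (forall t, 0 <= m t) -> 0 < \sum_t m t -> 0 <= c -> injective h ->
  (forall t, fiber k y (h t)) -> (forall t, u (h t) = c * m t) -> 0 < d ->
  ((c * went m (fun t => f (h t) + d)%R)%:E <=
   \int[mu]_(z in fiber k y) Ent_cond mu k f z)%E.
Proof.
move=> m0 mp; rewrite le_eqVlt => /predU1P[<-|c0] h_inj hf uE d0.
  by rewrite mul0r; apply: integral_ge0 => z _; exact: Ent_cond_ge0.
pose A := fiber k y; have mA := config_measurable A.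
rewrite (eq_integral (cst (Ent_cond mu k f y))); last first.
  by move=> z; rewrite inE => /fiber_eq Az; rewrite /Ent_cond /condE Az.
rewrite integral_cst// Ent_condE -/A.
have UE : mu A = (UA A)%:E by rewrite fineK//; exact: fin_num_measure.
have UN0 := fiber_mass_gt0 mp c0 h_inj hf uE.
rewrite [X in (_ * X)%E]UE -EFinM lee_fin divfK ?gt_eqF//.
exact: went_le_fiber.
Qed.

(** The summand of [siteentE] is constant along fibres of [k]; keeping only the representative with
    [x k = 0] absorbs the factor [#|T|]. *)
Let siteentE0 L (p : 'I_N -> 'I_L.+1 -> R) (V : {ffun 'I_N -> 'I_L.+1} -> R) k g :
  siteent p V k g = \sum_(x : {ffun 'I_N -> 'I_L.+1} | x k == ord0)
    restw p k x * went (kernw p V k x) (fun t => g (upd x k t)).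
Proof.
pose G (x : {ffun 'I_N -> 'I_L.+1}) := restw p k x * went (kernw p V k x) (fun t => g (upd x k t)).
have GE x t : G (upd x k t) = G x.
  rewrite /G kernw_upd; congr (_ * _).
    by apply: eq_bigr => i ik; rewrite ffunE (negbTE ik).
  by congr went; apply/funext => s; rewrite updK.
have T0 : #|'I_L.+1|%:R != 0 :> R by rewrite pnatr_eq0 card_ord.
apply: (mulfI T0); rewrite siteentE [in RHS]big_mkcond/= -(sum_upd k).
apply: eq_bigr => x _; rewrite (bigD1 ord0)//= ffunE eqxx eqxx [X in X + _]GE.
by rewrite big1 ?addr0// => t t0; rewrite ffunE eqxx (negbTE t0).
Qed.

(** Fibres through distinct representatives are disjoint, so their integrals add up to at most the
    integral over the whole space. *)
Lemma siteent_le_Ent_cond k L (p : 'I_N -> 'I_L.+1 -> R)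
    (V : {ffun 'I_N -> 'I_L.+1} -> R) d :
  (forall i t, 0 <= p i t) -> (forall i, 0 < \sum_t p i t) ->
  (forall x, u (tuple_of_box x) = gibbsw p V x) -> 0 < d ->
  ((siteent p V k (fun x => f (tuple_of_box x) + d)%R)%:E <=
   \int[mu]_y Ent_cond mu k f y)%E.
Proof.
move=> p0 pp uE d0; rewrite siteentE0 -sumEFin.
pose P := [pred x : {ffun 'I_N -> 'I_L.+1} | x k == ord0].
pose D := \big[setU/set0]_(x <- enum P) fiber k (tuple_of_box x).
apply: (@le_trans _ _ (\int[mu]_(y in D) Ent_cond mu k f y)%E); last first.
  apply: ge0_subset_integral => //; try exact: config_measurable.
  - exact: config_measurable_fun.
  - by move=> y _; exact: Ent_cond_ge0.
rewrite ge0_integral_bigsetU//=; first last.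
- by move=> y _; exact: Ent_cond_ge0.
- exact: config_measurable_fun.
- move=> x x'; rewrite /= !mem_enum !inE => /eqP xk /eqP x'k [z [zx zx']].
  apply/ffunP => j; apply: val_inj; have [->|jk] := eqVneq j k; first by rewrite xk x'k.
  by have := zx j jk; rewrite (zx' j jk) !tnth_mktuple.
- exact: enum_uniq.
- by move=> x; exact: config_measurable.
rewrite big_enum/=; apply: lee_sum => x _.
apply: went_le_Ent_cond => //.
- by move=> t; exact: kernw_ge0.
- by apply: (wsum_gt0 (p0 k) (pp k)) => t; exact: expR_gt0.
- exact: restw_ge0.
- move=> t t' /(@tuple_of_box_inj N L) /(congr1 (fun x : {ffun _} => x k)).
  by rewrite !ffunE eqxx.
- by move=> t j jk; rewrite !tnth_mktuple ffunE (negbTE jk).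
- by move=> t; rewrite uE gibbsw_upd.
Qed.

End ConditionalEntropy.

(** * Supremum norms and oscillation of the interaction *)

Section SupNorms.
Context {R : realType}.

Lemma supnorm_ge (T : Type) (f : T -> R) x : (supnorm f < +oo)%E ->
  `|f x| <= fine (supnorm f).
Proof.
move=> fy; have le1 : (`|f x|%:E <= supnorm f)%E.
  by apply: ereal_sup_ubound; exists x.
rewrite -lee_fin fineK// ge0_fin_numE// (le_trans _ le1)// lee_fin//.
Qed.

Lemma supnorm2_ge (g : nat -> nat -> R) a b : (supnorm2 g < +oo)%E ->
  `|g a b| <= fine (supnorm2 g).
Proof. exact: (@supnorm_ge _ (fun p : nat * nat => g p.1 p.2) (a, b)). Qed.

Lemma Fsup_ge N (F : 'I_N -> nat -> R) i n : (Fsup F < +oo)%E ->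
  `|F i n| <= fine (Fsup F).
Proof.
move=> Fy; have le1 : (supnorm (F i) <= Fsup F)%E by exact: le_bigmax.
have le2 : (`|F i n|%:E <= supnorm (F i))%E by apply: ereal_sup_ubound; exists n.
have le3 := le_trans le2 le1.
rewrite -lee_fin fineK// ge0_fin_numE// (le_trans _ le3)// lee_fin//.
Qed.

End SupNorms.

Section Interaction.
Context {R : realType} {N : nat}.
Variables (beta : R) (J : 'I_N -> 'I_N -> R) (w : 'I_N -> 'I_N -> nat -> nat -> R).
Hypothesis beta_gt0 : 0 < beta.
Hypothesis J_diag : forall i, J i i = 0.
Hypothesis J_sym : forall i j, J i j = J j i.
Hypothesis w_bounded : forall i j, (supnorm2 (w i j) < +oo)%E.
Hypothesis w_norm_sym : forall i j, supnorm2 (w i j) = supnorm2 (w j i).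
Implicit Types (i k j l : 'I_N) (y : config N).

Let nw j l : R := fine (supnorm2 (w j l)).
Let cp j l y : R := J j l * w j l (tnth y j) (tnth y l).

Let nw_ge0 j l : 0 <= nw j l.
Proof. exact: le_trans (supnorm2_ge 0 0 (w_bounded j l)). Qed.

Let cp_le j l y : `|cp j l y| <= `|J j l| * nw j l.
Proof. by rewrite normrM ler_wpM2l// supnorm2_ge. Qed.

Let tnth_setc y k n j : tnth (setc y k n) j = if j == k then n else tnth y j.
Proof. by rewrite tnth_mktuple. Qed.

Let sum_pair1 i k (c : R) :
  \sum_j \sum_l (if (j == i) && (l == k) then c else 0) = c.
Proof.
rewrite (bigD1 i)//= eqxx /= (bigD1 k)//= eqxx big1 ?addr0; last first.
  by move=> l lk; rewrite (negbTE lk).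
by rewrite big1 ?addr0// => j ji; rewrite big1// => l _; rewrite (negbTE ji).
Qed.

Lemma eps_ge0 i k : 0 <= eps beta J w i k.
Proof. by rewrite mulr_ge0 ?nw_ge0// mulr_ge0// mulr_ge0// ltW. Qed.

Lemma eps_sym i k : eps beta J w i k = eps beta J w k i.
Proof. by rewrite /eps J_sym w_norm_sym. Qed.

(** Only the ordered pairs [(i, k)] and [(k, i)] survive in the mixed difference, each at most
    [4 |J| ||w||]; with [beta] and the factor [1/2] of [W] this is [eps]. *)
Lemma W_mixed i k y (a a' b b' : nat) : i != k ->
  beta * W J w (setc (setc y i a) k b) + beta * W J w (setc (setc y i a') k b') <=
  eps beta J w i k + (beta * W J w (setc (setc y i a') k b) +
                      beta * W J w (setc (setc y i a) k b')).
Proof.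
move=> ik; pose s a b := setc (setc y i a) k b.
have sE c d j : tnth (s c d) j = if j == k then d else if j == i then c else tnth y j.
  by rewrite !tnth_setc.
pose B j l : R := (if (j == i) && (l == k) then 4 * (`|J k i| * nw i k) else 0) +
                  (if (j == k) && (l == i) then 4 * (`|J k i| * nw i k) else 0).
have step j l : cp j l (s a b) + cp j l (s a' b') -
    (cp j l (s a' b) + cp j l (s a b')) <= B j l.
  have four : cp j l (s a b) + cp j l (s a' b') -
      (cp j l (s a' b) + cp j l (s a b')) <= 4 * (`|J j l| * nw j l).
    have := cp_le j l (s a b); have := cp_le j l (s a' b').
    have := cp_le j l (s a' b); have := cp_le j l (s a b').
    rewrite !ler_norml => /andP[? ?] /andP[? ?] /andP[? ?] /andP[? ?]; lra.
  have B0 : 0 <= B j l.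
    by rewrite /B addr_ge0//; case: ifP => // _; rewrite !mulr_ge0.
  have [jk|jk] := eqVneq j k; have [lk|lk] := eqVneq l k.
  - rewrite (le_trans _ B0)// /cp !sE jk lk eqxx; lra.
  - have [li|li] := eqVneq l i.
      rewrite (le_trans four)// /B jk li [k == i]eq_sym (negbTE ik) !eqxx/= add0r.
      by rewrite /nw w_norm_sym.
    by rewrite (le_trans _ B0)// /cp !sE jk eqxx (negbTE lk) (negbTE li); lra.
  - have [ji|ji] := eqVneq j i.
      rewrite (le_trans four)// /B ji lk !eqxx/= (negbTE ik)/= addr0.
      by rewrite J_sym.
    by rewrite (le_trans _ B0)// /cp !sE lk eqxx (negbTE jk) (negbTE ji); lra.
  - by rewrite (le_trans _ B0)// /cp !sE (negbTE jk) (negbTE lk); lra.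
have sumB : \sum_j \sum_l B j l = 8 * (`|J k i| * nw i k).
  rewrite /B; under eq_bigr do rewrite big_split/=; rewrite big_split/= !sum_pair1.
  by ring.
have : \sum_j \sum_l (cp j l (s a b) + cp j l (s a' b') -
    (cp j l (s a' b) + cp j l (s a b'))) <= \sum_j \sum_l B j l.
  by apply: ler_sum => j _; apply: ler_sum.
under eq_bigr do rewrite sumrB !big_split/=.
rewrite sumrB !big_split/= sumB => h.
have b0 : 0 <= beta * 2^-1 by rewrite mulr_ge0 ?ltW// invr_gt0.
have := ler_wpM2l b0 h; rewrite /W -/(s a b) -/(s a' b') -/(s a' b) -/(s a b').
rewrite /eps -/(nw i k) -/(cp _ _ _).
rewrite mulrBr !mulrDr lerBlDr => /le_trans; rewrite !mulrA => hh.
have -> : 4 * beta * `|J k i| * nw i k = beta / 2 * 8 * `|J k i| * nw i k by field.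
apply: hh; lra.
Qed.

(** Only ordered pairs with exactly one entry [k] contribute, each at most [2 |J| ||w||]; the two
    orders and the factor [1/2] give [eps / 2] for each other site. *)
Lemma W_osc k y (n m : nat) : beta * W J w (setc y k n) <=
  beta * W J w (setc y k m) + 2^-1 * \sum_(l | l != k) eps beta J w k l.
Proof.
pose B1 j l : R := if (j == k) && (l != k) then 2 * (`|J l k| * nw k l) else 0.
pose B j l := B1 j l + B1 l j.
have step j l : cp j l (setc y k n) - cp j l (setc y k m) <= B j l.
  have two : cp j l (setc y k n) - cp j l (setc y k m) <= 2 * (`|J j l| * nw j l).
    have := cp_le j l (setc y k n); have := cp_le j l (setc y k m).
    by rewrite !ler_norml => /andP[? ?] /andP[? ?]; lra.
  rewrite /B /B1; have [jk|jk] := eqVneq j k; have [lk|lk] := eqVneq l k => /=.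
  - by rewrite /cp jk lk J_diag !mul0r; lra.
  - by rewrite addr0 (le_trans two)// jk J_sym.
  - by rewrite add0r (le_trans two)// lk /nw w_norm_sym.
  - by rewrite /cp !tnth_setc (negbTE jk) (negbTE lk) subrr addr0.
have sumB1 : \sum_j \sum_l B1 j l = \sum_(l | l != k) 2 * (`|J l k| * nw k l).
  rewrite (bigD1 k)//= [X in _ + X]big1 ?addr0; last first.
    by move=> j jk; rewrite big1// => l _; rewrite /B1 (negbTE jk).
  by rewrite [RHS]big_mkcond/=; apply: eq_bigr => l _; rewrite /B1 eqxx.
have sumB : \sum_j \sum_l B j l = \sum_(l | l != k) 4 * (`|J l k| * nw k l).
  rewrite /B; under eq_bigr do rewrite big_split/=; rewrite big_split/=.
  rewrite [X in _ + X]exchange_big/= sumB1 -big_split/=.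
  by apply: eq_bigr => l _; ring.
have : \sum_j \sum_l (cp j l (setc y k n) - cp j l (setc y k m)) <=
    \sum_j \sum_l B j l.
  by apply: ler_sum => j _; apply: ler_sum.
under eq_bigr do rewrite sumrB; rewrite sumrB sumB => h.
have b0 : 0 <= beta * 2^-1 by rewrite mulr_ge0 ?ltW// invr_gt0.
have := ler_wpM2l b0 h; rewrite mulrBr lerBlDl => h2.
rewrite /W [leLHS]mulrA [X in _ <= X + _]mulrA (le_trans h2)// lerD2l.
rewrite le_eqVlt; apply/orP; left; apply/eqP.
by rewrite !mulr_sumr; apply: eq_bigr => l _; rewrite /eps -/(nw k l); field.
Qed.

Lemma qmax_ge i : \sum_(k | k != i)
    expR (eps beta J w i k) * (expR (2 * eps beta J w i k) - 1) <= qmax beta J w.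
Proof.
rewrite /qmax; exact: (@le_bigmax _ _ _ 0 (fun i => \sum_(k | k != i)
  expR (eps beta J w i k) * (expR (2 * eps beta J w i k) - 1))).
Qed.

(** Termwise, [1 <= expR e] and [2 * e <= expR (2 * e) - 1]. When [qmax] is below [2/3], this puts
    the oscillation in [W_osc] below [1/6]. *)
Lemma sum_eps_le k : 2 * \sum_(l | l != k) eps beta J w k l <= qmax beta J w.
Proof.
rewrite (le_trans _ (qmax_ge k))// mulr_sumr; apply: ler_sum => l _.
have e0 := eps_ge0 k l; move: (eps _ _ _ _ _) e0 => e e0.
have h1 := expR_ge1Dx (2 * e).
have h2 : 1 <= expR e by rewrite -expR0 ler_expR.
nra.
Qed.

End Interaction.

(** * The Gibbs measure on the configuration space *)

Lemma exists_point_mass {R : realType} {N : nat} (mu : probability (config N) R)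
    (u : config N -> R) : (forall y, mu [set y] = (u y)%:E) -> exists y, 0 < u y.
Proof.
move=> muE; apply: contrapT => /forallNP nu.
have u0 y : u y = 0.
  apply/eqP; rewrite eq_le (point_mass_ge0 muE) andbT leNgt; exact/negP/nu.
have := @cvg_integral_box R N mu (cst 1%:E) (fun=> lee01).
rewrite integral_cst//= probability_setT mul1e.
have -> : (fun L => \int[mu]_(y in box L) cst 1%:E y)%E = (fun=> 0%E).
  apply/funext => L; rewrite (integral_box muE)//= big1// => x _.
  by rewrite u0 mule0.
move=> /(cvg_lim (@ereal_hausdorff R)); rewrite lim_cst// => /eqP.
by rewrite eq_sym onee_eq0.
Qed.

Theorem corollary2p5 (R : realType) (N : nat)
    (nu : probability nat R)
    (nu_ulc : forall n : nat, (1 <= n)%N ->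
       (n.+1)%:R / n%:R * mass nu n.+1 * mass nu n.-1 <= mass nu n ^+ 2)
    (F : 'I_N -> nat -> R) (F_bounded : (Fsup F < +oo)%E)
    (beta : R) (beta_gt0 : 0 < beta)
    (J : 'I_N -> 'I_N -> R)
    (J_diag : forall i, J i i = 0) (J_sym : forall i j, J i j = J j i)
    (w : 'I_N -> 'I_N -> nat -> nat -> R)
    (w_bounded : forall i j, (supnorm2 (w i j) < +oo)%E)
    (w_norm_sym : forall i j, supnorm2 (w i j) = supnorm2 (w j i))
    (mu : probability (config N) R)
    (mu_gibbs : forall x, mu [set x] = (gibbs_mass nu F beta J w x)%:E)
    (q_small : qmax beta J w < 2 / 3) :
  let C := (1 - 3 / 2 * qmax beta J w)^-1 in
  let C0 := expR (4 * fine (Fsup F)) * (mass nu 1 / mass nu 0) in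
  let K := C * C0 * expR (1 / 3) in
  (forall f : config N -> R,
     measurable_fun [set: config N] f -> (forall x, 0 <= f x) ->
     (supnorm f < +oo)%E ->
     (Ent mu f <= C%:E * \sum_(k < N) \int[mu]_x Ent_cond mu k f x)%E)
  /\
  (0 < mass nu 0 -> (forall n, mass nu n = 0 -> mass nu n.+1 = 0) ->
   forall f : config N -> R, (forall x, 0 <= f x) ->
     (Ent mu f <= K%:E * \sum_(i < N) \int[mu]_x dirichlet_density i f x)%E).
Proof.
move=> C C0 K; set q := qmax beta J w in q_small C C0 K *.
have C_gt0 : 0 < C by rewrite invr_gt0; lra.
have mass_ge0 n : 0 <= mass nu n by rewrite fine_ge0.
pose u x := gibbs_mass nu F beta J w x.
(* A configuration of positive mass forces [ci] and [c] to be positive, although they are inverses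
   of [fine] of sums that might be infinite; boxes containing it have positive mass. *)
have [y0 u_y0] := exists_point_mass mu_gibbs.
pose ci i : R := (fine (\esum_(n in [set: nat]) (mass nu n * expR (F i n))%:E)%E)^-1.
pose c : R := (fine (\esum_(x in [set: config N])
  (mu0 nu F x * expR (beta * W J w x))%:E)%E)^-1.
have p_ge0 i n : 0 <= mu0_site nu (F i) n.
  rewrite /mu0_site /normalize divr_ge0 ?mulr_ge0 ?expR_ge0// fine_ge0//.
  by apply: esum_ge0 => m _; rewrite lee_fin mulr_ge0 ?expR_ge0.
have mu0_ge0 x : 0 <= mu0 nu F x by rewrite prodr_ge0.
have c_ge0 : 0 <= c.
  rewrite invr_ge0 fine_ge0//; apply: esum_ge0 => x _.
  by rewrite lee_fin mulr_ge0 ?expR_ge0.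
have uE x : u x = mu0 nu F x * expR (beta * W J w x) * c by [].
have c_gt0 : 0 < c.
  rewrite lt0r c_ge0 andbT; apply: contraTneq u_y0 => c0.
  by rewrite -/(u y0) uE c0 mulr0 ltxx.
have p_y0 i : 0 < mu0_site nu (F i) (tnth y0 i).
  rewrite lt0r p_ge0 andbT; apply: contraTneq u_y0 => p0.
  by rewrite -/(u y0) uE /mu0 (bigD1 i)//= p0 !mul0r ltxx.
have pE i n : mu0_site nu (F i) n = ci i * (mass nu n * expR (F i n)).
  by rewrite /mu0_site /normalize -/(ci i) mulrC.
have ci_gt0 i : 0 < ci i.
  have := p_y0 i; rewrite pE => h; rewrite lt0r.
  rewrite invr_ge0 fine_ge0 ?andbT; last first.
    by apply: esum_ge0 => m _; rewrite lee_fin mulr_ge0 ?expR_ge0.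
  by apply: contraTneq h => ->; rewrite mul0r ltxx.
(* The normalising constant is absorbed into the potential, so that [u] on a box is exactly a Gibbs
   weight. *)
pose V y := beta * W J w y + ln c.
pose L0 := (\max_(j < N) tnth y0 j)%N.
have y0_box : box L0 y0 by move=> j; exact: (leq_bigmax j).
pose p L i (t : 'I_L.+1) := ci i * (mass nu t * expR (F i t)).
pose VL L (x : {ffun 'I_N -> 'I_L.+1}) := V (tuple_of_box x).
have p0 L i t : 0 <= p L i t by rewrite /p -pE.
have uL L (x : {ffun 'I_N -> 'I_L.+1}) : u (tuple_of_box x) = gibbsw (p L) (VL L) x.
  rewrite uE /gibbsw /VL /V expRD lnK ?posrE// mulrA; congr (_ * _ * _).
  by apply: eq_bigr => i _; rewrite tnth_mktuple pE.
have px0 L : (L0 <= L)%N -> exists x0 : {ffun 'I_N -> 'I_L.+1}, forall i, 0 < p L i (x0 i).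
  move=> L0L; have yL : box L y0 by move=> j; rewrite (leq_trans (y0_box j)).
  have [x0 x0E] := box_preimage yL; exists x0 => i.
  by have := p_y0 i; rewrite pE x0E tnth_mktuple.
have tens L (f : config N -> R) (d : R) : (L0 <= L)%N -> (forall y, 0 <= f y) -> 0 < d ->
    went (fun x : {ffun 'I_N -> 'I_L.+1} => u (tuple_of_box x))
         (fun x => f (tuple_of_box x) + d) <=
    C * \sum_k siteent (p L) (VL L) k (fun x => f (tuple_of_box x) + d).
  move=> L0L f0 d0; have [x0 px] := px0 L L0L.
  have -> : (fun x : {ffun 'I_N -> 'I_L.+1} => u (tuple_of_box x)) =
    gibbsw (p L) (VL L) by apply/funext => x; rewrite uL.
  apply: (tensorization (p0 L) px (eps := eps beta J w)) => //.
  - by move=> i k; exact: eps_sym.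
  - by move=> i k; exact: eps_ge0.
  - move=> i k x t t' v v' ik; rewrite /VL !tuple_of_box_upd /V.
    have := @W_mixed R N beta J w beta_gt0 J_sym w_bounded w_norm_sym i k
      (tuple_of_box x) t t' v v' ik; lra.
  - by move=> i; exact: qmax_ge.
  - by move=> x; rewrite ltr_wpDl.
have main (f : config N -> R) (D : R) (G : 'I_N -> \bar R) : (forall y, 0 <= f y) ->
    0 <= D -> (forall k, (0 <= G k)%E) ->
    (forall L k (d : R), (L0 <= L)%N -> 0 < d ->
       ((siteent (p L) (VL L) k (fun x => f (tuple_of_box x) + d)%R)%:E <=
        D%:E * G k)%E) ->
    (Ent mu f <= (C * D)%:E * \sum_(k < N) G k)%E.
  move=> f0 D0 G0 le; set RHS := (_ * _)%E.
  have R0 : (0 <= RHS)%E.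
    by rewrite mule_ge0 ?lee_fin ?mulr_ge0 ?(ltW C_gt0)// sume_ge0.
  (* An infinite right-hand side is trivial; otherwise it is the real bound that [Ent_le_of_box]
     takes. *)
  have [->|RN] := eqVneq RHS +oo%E; first exact: leey.
  have Rfin : RHS \is a fin_num by rewrite ge0_fin_numE// lt_neqAle RN leey.
  rewrite -(fineK Rfin); apply: (Ent_le_of_box mu_gibbs f0 y0_box u_y0) => L d L0L d0.
  rewrite -lee_fin (fineK Rfin) (le_trans (_ : _ <= (C * \sum_k
    siteent (p L) (VL L) k (fun x => f (tuple_of_box x) + d))%:E)%E)//.
    by rewrite lee_fin; exact: tens.
  rewrite /RHS !EFinM -muleA lee_wpmul2l ?lee_fin ?(ltW C_gt0)//.
  rewrite ge0_sume_distrr// -sumEFin; apply: lee_sum => k _; exact: le.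
split=> [f _ f0 f_bounded|nu0 nu_supp f f0].
- rewrite -[C]mulr1; apply: main => // [k|L k d L0L d0].
    apply: integral_ge0 => y _; apply: (@Ent_cond_ge0 R N mu f (fine (supnorm f))) => // z.
    by rewrite (le_trans (ler_norm _))// supnorm_ge.
  rewrite mul1e; have [x0 px] := px0 L L0L.
  apply: (@siteent_le_Ent_cond R N mu u f (fine (supnorm f))) => //.
  + by move=> y; rewrite (le_trans (ler_norm _))// supnorm_ge.
  + by move=> i; exact: (sum_p_gt0 (p0 L) px).
- have -> : K = C * (mass nu 1 / mass nu 0 * expR (4 * fine (Fsup F) + 1 / 3)).
    by rewrite /K /C0 expRD; ring.
  apply: main => // [|k|L k d L0L d0].
  + by rewrite mulr_ge0 ?expR_ge0// divr_ge0.
  + by apply: integral_ge0 => y _; exact: dirichlet_density_ge0.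
  rewrite (le_trans _ (lee_wpmul2l _ (dirichlet_box_le mu_gibbs f0 k L d0)))//; last first.
    by rewrite lee_fin mulr_ge0 ?expR_ge0// divr_ge0.
  rewrite -EFinM lee_fin.
  under [X in _ * X]eq_bigr do rewrite -/(u _) uL.
  apply: (@siteent_mlsi R (mass nu) N L mass_ge0 nu0 nu_supp nu_ulc ci F V
    (4 * fine (Fsup F) + 1 / 3) ci_gt0 _ k (fun y => f y + d)) => [j y n m|y]; last first.
    by rewrite ltr_wpDl.
  (* [F j] oscillates by at most [2 * fine (Fsup F)] and the interaction by at most [q / 4 < 1/6];
     together they stay below [4 * fine (Fsup F) + 1/3]. *)
  have Fn := Fsup_ge j n F_bounded; have Fm := Fsup_ge j m F_bounded.
  have := @W_osc R N beta J w beta_gt0 J_diag J_sym w_bounded w_norm_sym j y n m.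
  have := @sum_eps_le R N beta J w beta_gt0 w_bounded j; rewrite -/q /V.
  have F0 : 0 <= fine (Fsup F) by rewrite (le_trans _ Fn).
  move: Fn Fm; rewrite !ler_norml => /andP[? ?] /andP[? ?]; lra.
Qed.
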